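(* Let $\lambda>0$ and let $P_3(\theta_1,\theta_2,\theta_3)=1+p_1\theta_1+p_2\theta_2+p_3\theta_3+p_{1,2}\theta_1\theta_2+p_{1,3}\theta_1\theta_3+p_{2,3}\theta_2\theta_3+p_{1,2,3}\theta_1\theta_2\theta_3$ with $p_1,p_2,p_3,p_{1,2},p_{1,3},p_{2,3},p_{1,2,3}>0$ and $$\widetilde b_{1,2}=\frac{p_{1,3}p_{2,3}}{p_{1,2,3}^2}-\frac{p_3}{p_{1,2,3}}>0,\quad \widetilde b_{1,3}=\frac{p_{1,2}p_{2,3}}{p_{1,2,3}^2}-\frac{p_2}{p_{1,2,3}}>0,\quad \widetilde b_{2,3}=\frac{p_{1,3}p_{1,2}}{p_{1,2,3}^2}-\frac{p_1}{p_{1,2,3}}>0,$$ $$\widetilde b_{1,2,3}=-\frac1{p_{1,2,3}}+\frac{p_{2,3}p_1}{p_{1,2,3}^2}+\frac{p_{1,3}p_2}{p_{1,2,3}^2}+\frac{p_{1,2}p_3}{p_{1,2,3}^2}-\frac{2p_{2,3}p_{1,3}p_{1,2}}{p_{1,2,3}^3}>0.$$ Put $-\widetilde p_2=p_{1,3}/p_{1,2,3}$, $-\widetilde p_3=p_{1,2}/p_{1,2,3}$, $-\widetilde p_{2,3}=p_1/p_{1,2,3}$, and let $$S_{2,3}(\theta_2,\theta_3)=1+\tfrac{p_{1,2}}{p_1}\theta_2+\tfrac{p_{1,3}}{p_1}\theta_3+\tfrac{p_{1,2,3}}{p_1}\theta_2\theta_3,\quad S_2(\theta_2)=1+(-\widetilde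 p_2)^{-1}\theta_2,\quad S_3(\theta_3)=1+(-\widetilde p_3)^{-1}\theta_3,$$ $$\alpha_1=\tfrac{\widetilde b_{1,2}}{(-\widetilde p_2)},\ \alpha_2=\tfrac{\widetilde b_{1,3}}{(-\widetilde p_3)},\ \alpha_3=\tfrac{\widetilde b_{1,2,3}}{(-\widetilde p_{2,3})},\ \alpha_4=\tfrac{\widetilde b_{1,2}\widetilde b_{2,3}}{(-\widetilde p_2)(-\widetilde p_{2,3})},\ \alpha_5=\tfrac{\widetilde b_{1,3}\widetilde b_{2,3}}{(-\widetilde p_3)(-\widetilde p_{2,3})}.$$ Let $X_1\sim\gamma_{(p_1,\lambda)}$ and, given $X_1$, let $V_1,\dots,V_5$ be independent with $V_i\sim\mathcal P(\alpha_iX_1)$. (a) If $(X_1,X_2,X_3)\sim\boldsymbol\gamma_{(P_3,\lambda)}$, the Laplace transform of $(X_2,X_3)$ given $X_1=x_1$ is $$L_{(X_2,X_3)}^{X_1=x_1}=\sum_{\mathbf v\in\mathbb N^5}\Big[\prod_{i=1}^5\mathbf P(V_i=v_i\mid X_1=x_1)\Big]S_2^{-(v_1+v_4)}S_3^{-(v_2+v_5)}S_{2,3}^{-(\lambda+v_3+v_4+v_5)}.$$ (b) Given $X_1$ and $(V_1,\dots,V_5)$, let $Y_2\sim\gamma_{(S_2,V_1+V_4)}$, $Y_3\sim\gamma_{(S_3,V_2+V_5)}$ and $(Z_2,Z_3)\sim\boldsymbol\gamma_{(S_{2,3},\lambda+V_3+V_4+V_5)}$ be independent, and let $(X_2,X_3)=(Y_2+Z_2,Y_3+Z_3)$.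 Then $(X_1,X_2,X_3)\sim\boldsymbol\gamma_{(P_3,\lambda)}$.
   Context: For a polynomial $P$ of degree at most one in each variable with $P(\mathbf 0)=1$ and $\lambda>0$, the multivariate gamma distribution $\boldsymbol\gamma_{(P,\lambda)}$ is the probability distribution of a random vector $\mathbf X$ with $\mathbb E[\exp(-\sum_i\theta_iX_i)]=[P(\boldsymbol\theta)]^{-\lambda}$ for $\boldsymbol\theta$ in a set with non-empty interior; with shape parameter $0$ it is the point mass at $0$. In dimension one, $\gamma_{(a,\lambda)}$ with a number $a>0$ and $\gamma_{(1+a\theta,\lambda)}$ both denote the gamma distribution with Laplace transform $(1+a\theta)^{-\lambda}$. $\mathcal P(\mu)$ is the Poisson distribution with parameter $\mu$. $\mathbb N=\{0,1,2,\dots\}$. The conditional Laplace transform is $L_{(X_2,X_3)}^{X_1=x_1}(\theta_2,\theta_3)=\mathbb E[e^{-\theta_2X_2-\theta_3X_3}\mid X_1=x_1]$, and the formula gives a version of it for $x_1>0$, $\theta_2,\theta_3\ge0$. *)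

(* Defs.v *)
From HB Require Import structures.
From mathcomp Require Import all_boot all_order all_algebra.
From mathcomp Require Import all_classical all_reals all_analysis.
From mathcomp Require Import measurable_realfun.

Set Implicit Arguments.
Unset Strict Implicit.
Unset Printing Implicit Defensive.

Import Order.TTheory GRing.Theory Num.Theory.
Import numFieldNormedType.Exports.

Local Open Scope classical_set_scope.
Local Open Scope ring_scope.

(* Under mu, the random vector X has the distribution gamma_(Q, lam), for Q
   affine in each variable with Q 0 = 1 and lam >= 0. The
   identity is required only on some set U of non-empty interior, and X is not
   assumed non-negative. Positivity of Q on U makes the real power meaningful:
   on negative numbers `^ has a default value. *)
Definition multigamma (R : realType) (n : nat) (Q : 'rV[R]_n -> R) (lam : R)
    (d : measure_display) (T : measurableType d) (mu : probability T R)
    (X : n.-tuple (T -> R)) : Prop :=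
  if lam == 0 then {ae mu, forall t, forall i, tnth X i t = 0}
  else exists2 U : set 'rV[R]_n, U° !=set0 &
    forall theta, U theta -> 0 < Q theta /\
      ('E_mu[fun t => expR (- \sum_(i < n) theta 0%R i * tnth X i t)]
       = (Q theta `^ (- lam))%:E)%E.

(* The second argument of poisson_prob is a dummy. *)
Definition poisson (R : realType) (mu : R) : probability nat R :=
  poisson_prob mu 0%N.

(* x |-> g x is a version of E[Y | X = x]. *)
Definition cond_expectation (R : realType) (d d' : measure_display)
    (T : measurableType d) (A : measurableType d') (P : probability T R)
    (X : T -> A) (Y : T -> R) (g : A -> R) : Prop :=
  [/\ measurable_fun setT g,
      P.-integrable setT (fun t => (Y t)%:E),
      P.-integrable setT (fun t => (g (X t))%:E) &
      forall B : set A, measurable B ->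
        (\int[P]_(t in X @^-1` B) (g (X t))%:E
         = \int[P]_(t in X @^-1` B) (Y t)%:E)%E].

(* K is a regular conditional distribution of Y given X. Conditional
   independence is expressed by taking product measures for K x. *)
Definition cond_distribution (R : realType) (d d1 d2 : measure_display)
    (T : measurableType d) (A : measurableType d1) (B : measurableType d2)
    (P : probability T R) (X : T -> A) (Y : T -> B)
    (K : A -> {measure set B -> \bar R}) : Prop :=
  (forall C : set B, measurable C -> measurable_fun [set: A] (K ^~ C)) /\
  (forall (E : set A) (C : set B), measurable E -> measurable C ->
     (P (X @^-1` E `&` Y @^-1` C) = \int[P]_(t in X @^-1` E) K (X t) C)%E).

(* Main.v *)
(* Write M(th) = E[exp(-sum_i th_i X_i)]. The hypothesis gives M = Q^-lam only near
   one point, so the first task is to propagate it to the nonnegative orthant.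
   Along a coordinate line Q is affine, say A + B s. If M = (A + B s)^-lam near
   s0, then the tilted moments at s0 are those of a gamma law; they bound the
   integral of the hyperbolic cosine, so that M is finite and equal to its power
   series as long as |B (s - s0)| < A + B s0. Iterating reaches every s
   with A + B s > 0, and Q cannot vanish before M becomes infinite. Since M(0) = 1,
   M is finite on the convex hull of 0 and of the initial open set, and shrinking
   boxes towards 0 along coordinate lines carries the identity into a
   neighbourhood of 0, from which every point of the orthant is reached.

   Summing the five Poisson series turns the mixture of (a) into
   S23^-lam exp(c x1) with c <= 0 depending on (t2, t3), and
   S23 (1 + p1 (t1 - c)) = P3. Hence both sides of (a), weighted by
   exp(-t1 X1), have expectation P3^-lam, and (a) follows from the uniqueness
   of Laplace transforms. For (b), condition on each value of (V1, ..., V5)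
   separately and sum. *)

Require Import Defs.
From HB Require Import structures.
From mathcomp Require Import all_boot all_order all_algebra.
From mathcomp Require Import all_classical all_reals all_analysis.
From mathcomp Require Import measurable_realfun.
From mathcomp Require Import ring lra.

Set Implicit Arguments.
Unset Strict Implicit.
Unset Printing Implicit Defensive.

Import Order.TTheory GRing.Theory Num.Theory.
Import numFieldNormedType.Exports.

Local Open Scope classical_set_scope.
Local Open Scope ring_scope.

(** * Binomial series and power series coefficients *)

(** On an oblique segment towards 0 the polynomial [Q] can have degree up to [n]; only along
    coordinate lines is its power a binomial series, which forces coordinates to be moved one at a
    time. Agreement of power series does not make an integral finite, so finiteness has to be
    obtained separately, by Fatou's lemma or by convexity. The origin of [S23] and of the five
    Poisson parameters: [P3] is affine in [t1] with slope [p1 * S23], hence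
    [P3 = S23 * (1 + p1 * (t1 - c))] for [c = (1 - P3 0 t2 t3 / S23) / p1]. The alpha_i are the
    coefficients of a decomposition of [c] into terms [z - 1], where [z] is one of the inverses of
    [S2], [S3], [S23], [S2 * S23], [S3 * S23]; each term is the exponent of a Poisson generating
    function. Positivity of [b12], [b13], [b23], [b123] makes all alpha_i positive. As [z <= 1] on
    the orthant, [c <= 0], so [t1 - c] stays on the half-line where the transform of [X1] is
    known. *)

Lemma is_cvg_series_ratio (R : realType) (u : R^nat) (r : R) (N : nat) :
  0 <= r < 1 -> (forall n, 0 <= u n) ->
  (forall n, (N <= n)%N -> u n.+1 <= r * u n) -> cvgn (series u).
Proof.
move=> /andP[r0 r1] u0 ur.
(* From [N] on, the partial sum plus the geometric bound [u n / (1 - r)] of the tail does not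
   increase; [M] is its value at [N]. *)
pose M := series u N + u N / (1 - r).
have r1' : 0 < 1 - r by rewrite subr_gt0.
have nds : nondecreasing_seq (series u).
  by apply: nondecreasing_series => n _ _; exact: u0.
have bnd n : series u (n + N)%N + u (n + N)%N / (1 - r) <= M.
  elim: n => [|n IH]; first by rewrite add0n.
  apply: le_trans IH; rewrite addSn seriesSr -addrA lerD2l.
  have : u (n + N)%N.+1 / (1 - r) <= r * u (n + N)%N / (1 - r).
    by rewrite ler_pM2r ?invr_gt0// ur// leq_addl.
  move=> h; apply: le_trans (lerD (lexx (u (n + N)%N)) h) _.
  suff -> : u (n + N)%N + r * u (n + N)%N / (1 - r) = u (n + N)%N / (1 - r) by [].
  by field; rewrite gt_eqF.
apply: nondecreasing_is_cvgn => //; exists M => _ [n _ <-].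
apply: le_trans (bnd n); rewrite -[leLHS]addr0 lerD//.
  by apply: nds; exact: leq_addr.
by rewrite divr_ge0// ltW.
Qed.

(* [gbinom a n] is the coefficient of [x ^+ n] in [(1 - x) `^ (- a)] *)
Fixpoint gbinom (R : realType) (a : R) (n : nat) : R :=
  if n is m.+1 then gbinom a m * (a + m%:R) / m.+1%:R else 1.

Lemma gbinom_gt0 (R : realType) (a : R) n : 0 < a -> 0 < gbinom a n.
Proof.
move=> a0; elim: n => //= n IH.
by rewrite divr_gt0// mulr_gt0// ltr_wpDr.
Qed.

Lemma gbinom_diffs (R : realType) (a : R) :
  pseries_diffs (gbinom a) = (fun n => a * gbinom (a + 1) n).
Proof.
apply/funext => n; rewrite /pseries_diffs.
elim: n => [|n IH]; first by rewrite /=; field.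
have n1 : n.+1%:R != 0 :> R by [].
have E : gbinom a n.+1 = a * gbinom (a + 1) n / n.+1%:R by rewrite -IH; field.
rewrite [gbinom a n.+2]/= -/(gbinom a n.+1) [gbinom _ n.+1 in RHS]/= E.
by field; rewrite ?nat1r ?natr1 ?pnatr_eq0 -?(natrD _ 2) ?pnatr_eq0.
Qed.

(** Coefficient form of [(1 - x)]^ (- a) = (1 - x) * (1 - x) [^ (- (a + 1))]. *)
Lemma gbinom_pascal (R : realType) (a : R) n :
  gbinom a n.+1 = gbinom (a + 1) n.+1 - gbinom (a + 1) n.
Proof.
have n1 : n.+1%:R != 0 :> R by [].
have := congr1 (fun f => f n) (gbinom_diffs a); rewrite /pseries_diffs => E.
have -> : gbinom a n.+1 = a * gbinom (a + 1) n / n.+1%:R by rewrite -E; field.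
by rewrite /=; field; rewrite ?nat1r ?natr1 ?pnatr_eq0.
Qed.

Lemma is_cvg_gbinom (R : realType) (a x : R) : 0 < a -> `|x| < 1 ->
  cvgn (pseries (gbinom a) x).
Proof.
move=> a0 x1.
pose k := (1 + `|x|) / 2.
have xk : `|x| < k by rewrite /k; lra.
have k1 : k < 1 by rewrite /k; lra.
have k0 : 0 < k by rewrite (le_lt_trans _ xk).
apply: (@is_cvg_pseries_inside _ _ k); last by rewrite (gtr0_norm k0).
pose r := (1 + k) / 2.
have kr : k < r by rewrite /r; lra.
have r1 : r < 1 by rewrite /r; lra.
(* The ratio of consecutive terms is [k * (a + n) / (n + 1)], which is at most [r] once
   [k * a <= (r - k) * n]. *)
pose N := (Num.truncn (k * a / (r - k))).+1.
apply: (@is_cvg_series_ratio _ _ r N).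
- by rewrite r1 andbT ltW// (lt_trans k0).
- by move=> n; rewrite mulr_ge0// ?ltW ?gbinom_gt0// exprn_gt0.
- move=> n Nn; rewrite /= exprS.
  rewrite (_ : _ * (k * _) =
    (k * (a + n%:R) / n.+1%:R) * (gbinom a n * k ^+ n)); last first.
    by field.
  rewrite ler_pM2r ?mulr_gt0 ?gbinom_gt0 ?exprn_gt0//.
  rewrite ler_pdivrMr//.
  have : k * a / (r - k) < n%:R.
    apply: lt_le_trans (truncnS_gt _) _; rewrite ler_nat; exact: Nn.
  rewrite ltr_pdivrMr; last by rewrite subr_gt0.
  by move: r1 k0; rewrite -natr1; nra.
Qed.

Lemma binomial_series (R : realType) (a x : R) : 0 < a -> `|x| < 1 ->
  pseries (gbinom a) x @ \oo --> (1 - x) `^ (- a).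
Proof.
move=> a0 x1.
pose F (b y : R) : R := limn (pseries (gbinom b) y).
have FE (b y : R) : 0 < b -> `|y| < 1 -> (1 - y) * F (b + 1) y = F b y.
  move=> b0 y1.
  have c1 : cvgn (pseries (gbinom (b + 1)) y).
    by apply: is_cvg_gbinom => //; rewrite addr_gt0.
  rewrite mulrBl mul1r; apply/esym/cvg_lim => //.
  rewrite -cvg_shiftS.
  rewrite (_ : [sequence _]_n = (fun n => pseries (gbinom (b + 1)) y n.+1
      - y * pseries (gbinom (b + 1)) y n)).
    apply: cvgB; first by rewrite (cvg_shiftS (pseries (gbinom (b + 1)) y)).
    by apply: cvgMr.
  apply/funext => n; rewrite /pseries /series /= big_nat_recl//=.
  rewrite [X in X - _]big_nat_recl//= mulr_sumr -addrA -sumrB; congr (_ + _).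
  apply: eq_bigr => i _; rewrite -/(gbinom b i.+1) -/(gbinom (b + 1) i.+1).
  by rewrite gbinom_pascal exprS; ring.
have dF (b y : R) : 0 < b -> `|y| < 1 -> is_derive y 1 (F b) (b * F (b + 1) y).
  move=> b0 y1; pose K := (1 + `|y|) / 2.
  have K1 : `|K| < 1 by rewrite ger0_norm /K; [lra|rewrite divr_ge0// addr_ge0].
  have yK : `|y| < `|K| by rewrite [`|K|]ger0_norm /K; [lra|rewrite divr_ge0// addr_ge0].
  have dc c z : 0 < c -> `|z| < 1 ->
      pseries (fun n => b * gbinom c n) z @ \oo --> b * F c z.
    move=> c0 z1; rewrite (_ : pseries _ _ = b *: pseries (gbinom c) z).
      by apply: cvgZr; exact: is_cvg_gbinom.
    apply/funext => n; rewrite fctE /pseries /series /= scaler_sumr.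
    by apply: eq_bigr => i _; rewrite /GRing.scale/= mulrA.
  have := @pseries_snd_diffs _ (gbinom b) K y.
  have diff2 : pseries_diffs (fun n => b * gbinom (b + 1) n) =
     (fun n => b * ((b + 1) * gbinom (b + 1 + 1) n)).
    apply/funext => n; rewrite -(congr1 (fun f => f n) (gbinom_diffs (b + 1))).
    by rewrite /pseries_diffs mulrCA.
  have -> : b * F (b + 1) y = limn (pseries (pseries_diffs (gbinom b)) y).
    rewrite gbinom_diffs; apply/esym/cvg_lim => //.
    by apply: dc => //; rewrite addr_gt0.
  apply=> //; rewrite ?gbinom_diffs ?diff2.
  - exact: is_cvg_gbinom.
  - by apply: cvgP; apply: dc => //; rewrite addr_gt0.
  - rewrite (_ : pseries _ _ = (b * (b + 1)) *: pseries (gbinom (b + 1 + 1)) K).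
      by apply: is_cvgZr; apply: is_cvg_gbinom => //; rewrite !addr_gt0.
    apply/funext => n; rewrite fctE /pseries /series /= scaler_sumr.
    by apply: eq_bigr => i _; rewrite /GRing.scale/= !mulrA.
pose G (y : R) := F a y * (1 - y) `^ a.
have dG (y : R) : `|y| < 1 -> is_derive y 1 G 0.
  move=> y1.
  have y1' : 0 < 1 - y by rewrite subr_gt0 (le_lt_trans (ler_norm _)).
  have d1 := dF _ _ a0 y1.
  have d2 : is_derive y 1 (fun z : R => (1 - z) `^ a) (a * (1 - y) `^ (a - 1) * -1).
    have h1 : is_derive (1 - y) 1 (fun z : R => z `^ a) (a * (1 - y) `^ (a - 1)).
      exact: is_derive1_powR.
    have h2 : is_derive y 1 (fun z : R => 1 - z) (-1 : R).
      by apply: is_derive_eq; rewrite add0r mul1r.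
    exact: (@is_derive1_comp _ (fun z : R => z `^ a) (fun z => 1 - z)).
  rewrite /G; apply: is_derive_eq.
  rewrite /GRing.scale/= -(FE _ _ a0 y1).
  by rewrite -(mulr_powRB1 (ltW y1') a0); ring.
have G0 : G 0 = 1.
  rewrite /G subr0 powR1 mulr1 /F; apply/cvg_lim => //.
  rewrite -cvg_shiftS (_ : [sequence _]_n = cst 1); first exact: cvg_cst.
  apply/funext => n; rewrite /pseries /series /= big_nat_recl//= expr0 mulr1.
  by rewrite big1 ?addr0// => i _; rewrite expr0n/= mulr0.
have GE : G x = 1.
  rewrite -G0; apply/eqP; rewrite -subr_eq0; apply/eqP.
  have cG z : `|z| < 1 -> {for z, continuous G}.
    by move=> z1; apply/differentiable_continuous/derivable1_diffP; case: (dG z z1).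
  have [x0|x0] := leP 0 x.
    have [z||z zx] := @MVT_segment _ G (fun=> 0) 0 x x0; last by rewrite mul0r.
      rewrite in_itv/= => /andP[z0 zx]; apply: dG.
      by rewrite gtr0_norm// (lt_trans zx)// (le_lt_trans (ler_norm _)).
    apply: continuous_in_subspaceT => z; rewrite inE/= in_itv/= => /andP[z0 zx].
    by apply: cG; rewrite ger0_norm// (le_lt_trans zx)// (le_lt_trans (ler_norm _)).
  have xN : - x < 1 by rewrite -ltr0_norm.
  have [z||z zx] := @MVT_segment _ G (fun=> 0) x 0 (ltW x0); last first.
  + by rewrite mul0r => /eqP; rewrite subr_eq0 => /eqP ->; rewrite subrr.
  + apply: continuous_in_subspaceT => z; rewrite inE/= in_itv/= => /andP[z0 zx].
    by apply: cG; rewrite ler0_norm//; lra.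
  + rewrite in_itv/= => /andP[z0 zx]; apply: dG.
    by rewrite ltr0_norm//; lra.
have p0 : (1 - x) `^ a != 0.
  by rewrite gt_eqF// powR_gt0// subr_gt0 (le_lt_trans (ler_norm _)).
rewrite powRN; have <- : F a x = ((1 - x) `^ a)^-1.
  by apply: (mulIf p0); rewrite mulVf.
exact: is_cvg_gbinom.
Qed.

Lemma pseries_cvg0_head (R : realType) (c : R^nat) (d : R) : 0 < d ->
  (forall x, 0 < `|x| < d -> pseries c x @ \oo --> (0 : R)) -> c 0%N = 0.
Proof.
move=> d0 H; apply: contrapT => /eqP c0.
have e0 : 0 < `|c 0%N| by rewrite normr_gt0.
have x1d : 0 < `|d / 2| < d.
  by rewrite gtr0_norm ?divr_gt0//; apply/andP; split; lra.
have /cvgP/cvg_series_bounded[K [_ Kb]] := H _ x1d.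
pose M := `|K| + 1.
have MK : K < M by rewrite /M (le_lt_trans (ler_norm _))// ltrDl.
have M0 : 0 < M by rewrite /M ltr_wpDl.
have cM n : `|c n * (d / 2) ^+ n| <= M by exact: Kb MK n I.
(* At [t * (d / 2)] the tail is at most [2 * M * t]; this [t] makes it at most half of [|c 0|], so
   the partial sums cannot tend to 0. *)
pose t := `|c 0%N| / (4 * M + 2 * `|c 0%N|).
have D0 : 0 < 4 * M + 2 * `|c 0%N| by rewrite addr_gt0 ?mulr_gt0.
have t0 : 0 < t by rewrite divr_gt0.
have t2 : t <= 1 / 2 by rewrite /t ler_pdivrMr//; lra.
have tM : 2 * M * t <= `|c 0%N| / 2 by rewrite /t mulrA ler_pdivrMr//; nra.
have geo N : \sum_(0 <= i < N) t ^+ i.+1 <= 2 * t - 2 * t ^+ N.+1.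
  elim: N => [|N IH]; first by rewrite big_nil expr1 subrr.
  rewrite big_nat_recr//=; apply: le_trans (lerD IH (lexx _)) _.
  have : 0 < t ^+ N.+1 by rewrite exprn_gt0.
  by rewrite (exprS t N.+1); nra.
have txd : 0 < `|t * (d / 2)| < d.
  have t'0 : 0 < t * (d / 2) by rewrite mulr_gt0// divr_gt0.
  by rewrite gtr0_norm// t'0/=; nra.
have /cvgrPdist_lt/(_ (`|c 0%N| / 4)) := H _ txd.
case=> [|N _ /(_ N.+1 (leqnSn _))]; first by rewrite divr_gt0.
rewrite /= sub0r normrN /pseries /series /= big_nat_recl// expr0 mulr1.
set S := \sum_(0 <= i < N) _ => cS.
have SM : `|S| <= 2 * M * t.
  apply: le_trans (ler_norm_sum _ _ _) _.
  apply: (@le_trans _ _ (M * \sum_(0 <= i < N) t ^+ i.+1)).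
    rewrite mulr_sumr; apply: ler_sum => i _.
    rewrite exprMn mulrCA normrM mulrC (gtr0_norm (exprn_gt0 _ t0)).
    by rewrite ler_pM2r ?exprn_gt0.
  have := geo N; have : 0 < t ^+ N.+1 by rewrite exprn_gt0.
  by nra.
have : `|c 0%N| <= `|c 0%N + S| + `|S|.
  by rewrite -{1}(addrK S (c 0%N)); apply: ler_normB.
by lra.
Qed.

(** Excluding [x = 0] from the hypothesis makes it pass to the shifted series, which is the given
    one divided by [x] once the head is known to vanish. *)
Lemma pseries_eq0 (R : realType) (c : R^nat) (d : R) : 0 < d ->
  (forall x, 0 < `|x| < d -> pseries c x @ \oo --> (0 : R)) -> forall n, c n = 0.
Proof.
move=> d0 H n; elim: n c H => [|n IH] c H; first exact: pseries_cvg0_head H.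
apply: (IH (fun k => c k.+1)) => x xd.
have x0 : x != 0 by rewrite -normr_gt0; case/andP: xd.
have c0 := pseries_cvg0_head d0 H.
rewrite (_ : pseries _ _ = (fun N => x^-1 * pseries c x N.+1)).
  rewrite -(mulr0 x^-1); apply: cvgMr.
  by rewrite (cvg_shiftS (pseries c x)); exact: H.
apply/funext => N; rewrite /pseries /series /= big_nat_recl// c0 mul0r add0r.
by rewrite mulr_sumr; apply: eq_bigr => i _; rewrite exprS; field.
Qed.

(** * Moment generating functions *)

Lemma series_exp_coeff_le (R : realType) (y : R) n :
  \sum_(0 <= k < n) `|y| ^+ k / k`!%:R <= expR `|y|.
Proof.
have nd : nondecreasing_seq (series (exp_coeff `|y|)).
  by apply: nondecreasing_series => k _ _; exact: exp_coeff_ge0.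
exact: (nondecreasing_cvgn_le nd (is_cvg_series_exp_coeff _) n).
Qed.

Lemma expR_norm_le (R : realType) (x y h : R) : `|x| <= h ->
  expR `|x * y| <= expR (h * y) + expR (- h * y).
Proof.
move=> xh.
have H : expR `|x * y| <= expR (h * `|y|) by rewrite ler_expR normrM ler_wpM2r.
apply: le_trans H _.
case: (ger0P y) => y0; first by rewrite lerDl expR_ge0.
by rewrite mulrN -mulNr lerDr expR_ge0.
Qed.

Lemma integrable_ge0 d (T : measurableType d) (R : realType)
    (mu : {measure set T -> \bar R}) (f : T -> R) :
  measurable_fun setT f -> (forall w, 0 <= f w) ->
  (\int[mu]_w (f w)%:E < +oo)%E -> mu.-integrable setT (fun w => (f w)%:E).
Proof.
move=> mf f0 fi; apply/integrableP; split; first exact/measurable_EFinP.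
by under eq_integral => w _ do rewrite gee0_abs ?lee_fin//.
Qed.

Lemma le_integral_EFin d (T : measurableType d) (R : realType)
    (mu : {measure set T -> \bar R}) (f g : T -> R) :
  measurable_fun setT f -> measurable_fun setT g ->
  (forall w, 0 <= f w) -> (forall w, f w <= g w) ->
  (\int[mu]_w (f w)%:E <= \int[mu]_w (g w)%:E)%E.
Proof.
move=> mf mg f0 fg; apply: ge0_le_integral => //.
- by move=> w _; rewrite lee_fin.
- exact/measurable_EFinP.
- exact/measurable_EFinP.
- by move=> w _; rewrite lee_fin.
Qed.

Definition mgf (R : realType) d (T : measurableType d)
    (mu : {measure set T -> \bar R}) (Y Z : T -> R) (x : R) : \bar R :=
  (\int[mu]_w (expR (x * Y w + Z w))%:E)%E.

Definition tilted_moment (R : realType) d (T : measurableType d)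
    (mu : {measure set T -> \bar R}) (Y Z : T -> R) (n : nat) : R :=
  \int[mu]_w (Y w ^+ n * expR (Z w)).

Lemma mgf_ge0 (R : realType) d (T : measurableType d)
    (mu : {measure set T -> \bar R}) (Y Z : T -> R) (x : R) :
  (0 <= mgf mu Y Z x)%E.
Proof. by apply: integral_ge0 => w _; rewrite lee_fin expR_ge0. Qed.

Lemma measurable_expR_affine (R : realType) d (T : measurableType d)
    (Y Z : T -> R) (x : R) :
  measurable_fun setT Y -> measurable_fun setT Z ->
  measurable_fun setT (fun w => expR (x * Y w + Z w)).
Proof.
move=> mY mZ; apply: measurableT_comp => //.
by apply: measurable_funD => //; apply: measurable_funM.
Qed.

Lemma mgf_integrable (R : realType) d (T : measurableType d)
    (mu : {measure set T -> \bar R}) (Y Z : T -> R) (x : R) :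
  measurable_fun setT Y -> measurable_fun setT Z ->
  (mgf mu Y Z x < +oo)%E ->
  mu.-integrable setT (fun w => (expR (x * Y w + Z w))%:E).
Proof.
move=> mY mZ fi; apply: integrable_ge0 => //.
  exact: measurable_expR_affine.
Qed.

Lemma exp_partial_integrable (R : realType) d (T : measurableType d)
    (mu : {measure set T -> \bar R}) (Y Z : T -> R) (x : R) (N : nat) :
  (forall n, mu.-integrable setT (fun w => (Y w ^+ n * expR (Z w))%:E)) ->
  mu.-integrable setT
    (fun w => ((\sum_(0 <= k < N) (x * Y w) ^+ k / k`!%:R) * expR (Z w))%:E).
Proof.
move=> mi.
have := @integrable_sum _ _ _ mu setT measurableT _ (index_iota 0 N) xpredT
  (fun k w => ((x ^+ k / k`!%:R)%:E * (Y w ^+ k * expR (Z w))%:E)%E).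
move=> /(_ (fun k _ => integrableZl measurableT _ (mi k))).
apply: eq_integrable => // w _; rewrite mulr_suml -sumEFin.
by apply: eq_bigr => k _; rewrite -EFinM exprMn; congr EFin; ring.
Qed.

Lemma integral_exp_partial (R : realType) d (T : measurableType d)
    (mu : {measure set T -> \bar R}) (Y Z : T -> R) (x : R) (N : nat) :
  (forall n, mu.-integrable setT (fun w => (Y w ^+ n * expR (Z w))%:E)) ->
  (\int[mu]_w ((\sum_(0 <= k < N) (x * Y w) ^+ k / k`!%:R) * expR (Z w))%:E
   = (pseries (fun n => tilted_moment mu Y Z n / n`!%:R) x N)%:E)%E.
Proof.
move=> mi; transitivity (\sum_(0 <= k < N)
    \int[mu]_w ((x ^+ k / k`!%:R)%:E * (Y w ^+ k * expR (Z w))%:E))%E.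
  rewrite -integral_sum//; last by move=> k; exact: integrableZl.
  apply: eq_integral => w _; rewrite mulr_suml -sumEFin.
  by apply: eq_bigr => k _; rewrite -EFinM exprMn; congr EFin; ring.
rewrite -sumEFin; apply: eq_bigr => k _; rewrite integralZl//.
rewrite /tilted_moment /Rintegral.
have /fineK <- := integrable_fin_num measurableT (mi k).
by rewrite -EFinM; congr EFin => /=; ring.
Qed.

Section mgf_series.
Context (R : realType) d (T : measurableType d).
Variables (mu : {measure set T -> \bar R}) (Y Z : T -> R) (h : R).
Hypotheses (mY : measurable_fun setT Y) (mZ : measurable_fun setT Z).
Hypotheses (h0 : 0 < h).
Hypotheses (fh : (mgf mu Y Z h < +oo)%E) (fNh : (mgf mu Y Z (- h) < +oo)%E).

(** Dominates every tilted partial sum of the exponential series for [|x| <= h]; its integrability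
    is exactly finiteness at the two endpoints. *)
Let G w := expR (h * Y w + Z w) + expR (- h * Y w + Z w).

Let iG : mu.-integrable setT (fun w => (G w)%:E).
Proof.
have := integrableD measurableT (mgf_integrable mY mZ fh) (mgf_integrable mY mZ fNh).
by apply: eq_integrable.
Qed.

Let G0 w : 0 <= G w. Proof. by rewrite addr_ge0 ?expR_ge0. Qed.

Let GE x w : `|x| <= h -> expR `|x * Y w| * expR (Z w) <= G w.
Proof.
move=> xh; rewrite /G !expRD -mulrDl ler_pM2r ?expR_gt0//.
exact: expR_norm_le.
Qed.

Let mYn n : measurable_fun setT (fun w => Y w ^+ n * expR (Z w)).
Proof.
by apply: measurable_funM; [exact: measurable_funX|exact: measurableT_comp].
Qed.

Lemma tilted_moment_integrable n :
  mu.-integrable setT (fun w => (Y w ^+ n * expR (Z w))%:E).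
Proof.
pose k := h ^+ n / n`!%:R.
have k0 : 0 < k by rewrite divr_gt0 ?exprn_gt0 ?ltr0n ?fact_gt0.
have := integrableZl measurableT k^-1 iG; apply: le_integrable => //.
  exact/measurable_EFinP.
move=> w _; rewrite -EFinM !abse_EFin lee_fin.
rewrite [leRHS]ger0_norm ?mulr_ge0 ?invr_ge0 ?(ltW k0)//.
rewrite [leRHS]mulrC ler_pdivlMr// normrM (ger0_norm (expR_ge0 _)).
apply: (@le_trans _ _ (expR `|h * Y w| * expR (Z w))); last first.
  by apply: GE; rewrite gtr0_norm.
rewrite mulrAC ler_pM2r ?expR_gt0//.
apply: le_trans (series_exp_coeff_le _ n.+1).
rewrite big_nat_recr//= normrM exprMn (gtr0_norm h0) normrX /k.
rewrite mulrCA mulrA lerDr sumr_ge0// => i _.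
by rewrite divr_ge0// exprn_ge0// mulr_ge0// ltW.
Qed.

Lemma mgf_fin_num x : `|x| <= h -> mgf mu Y Z x \is a fin_num.
Proof.
move=> xh; rewrite ge0_fin_numE ?mgf_ge0//.
apply: (@le_lt_trans _ _ (\int[mu]_w (G w)%:E)%E); last first.
  case/integrableP: iG => _; under eq_integral => w _.
    by rewrite gee0_abs ?lee_fin//; over.
  by [].
apply: le_integral_EFin => //.
- exact: measurable_expR_affine.
- by apply: measurable_funD; exact: measurable_expR_affine.
- move=> w; apply: le_trans (GE _ xh).
  by rewrite expRD ler_pM2r ?expR_gt0// ler_expR ler_norm.
Qed.

(** Dominated convergence with [G]. The endpoint [|x| = h] is included, and [gamma_mgf_disc] uses
    the lemma precisely there, with [h] equal to the absolute value of its point. *)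
Lemma mgf_series x : `|x| <= h ->
  pseries (fun n => tilted_moment mu Y Z n / n`!%:R) x @ \oo
    --> fine (mgf mu Y Z x).
Proof.
move=> xh.
pose f N w := (\sum_(0 <= k < N) (x * Y w) ^+ k / k`!%:R) * expR (Z w).
have fG N w : `|f N w| <= G w.
  rewrite normrM (ger0_norm (expR_ge0 _)).
  apply: le_trans (GE _ xh); rewrite ler_pM2r ?expR_gt0//.
  apply: le_trans (series_exp_coeff_le _ N).
  apply: le_trans (ler_norm_sum _ _ _) _; apply: ler_sum => i _.
  by rewrite normrM normrX normfV (@ger0_norm _ i`!%:R).
have mf N : measurable_fun setT (f N).
  apply: measurable_funM; last exact: measurableT_comp.
  apply: measurable_sum => k; apply: measurable_funM => //.
  by apply: measurable_funX; apply: measurable_funM.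
have := @dominated_convergence _ _ _ mu setT measurableT
  (fun N w => (f N w)%:E) (fun w => (expR (x * Y w + Z w))%:E)
  (fun w => (G w)%:E).
case=> //.
- by move=> N; exact/measurable_EFinP.
- by apply/measurable_EFinP; exact: measurable_expR_affine.
- apply: aeW => w _; apply: cvg_EFin; first exact: nearW.
  rewrite /= expRD; apply: cvgMl.
  exact: is_cvg_series_exp_coeff.
- by apply: aeW => w N _; rewrite lee_fin fG.
move=> _ _; rewrite -[X in _ --> X]/(mgf mu Y Z x).
rewrite -(fineK (mgf_fin_num xh)) => /fine_cvgP[_].
rewrite (_ : _ \o _ = pseries (fun n => tilted_moment mu Y Z n / n`!%:R) x)//.
apply/funext => N /=.
by rewrite integral_exp_partial//; exact: tilted_moment_integrable.
Qed.

End mgf_series.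

(** * Continuation of a gamma transform along a line *)

Section gamma_mgf.
Context (R : realType) d (T : measurableType d).
Variables (mu : {measure set T -> \bar R}) (Y Z : T -> R).
Hypotheses (mY : measurable_fun setT Y) (mZ : measurable_fun setT Z).
Variables (K b a e : R).
Hypotheses (a0 : 0 < a) (e0 : 0 < e).
Hypothesis mgfE : forall x, `|x| < e ->
  mgf mu Y Z x = (K * (1 - b * x) `^ (- a))%:E.

Let h0 : 0 < e / 2. Proof. by rewrite divr_gt0. Qed.

Let fin (x : R) : `|x| < e -> (mgf mu Y Z x < +oo)%E.
Proof. by move=> xe; rewrite mgfE// ltry. Qed.

Let fh : (mgf mu Y Z (e / 2) < +oo)%E.
Proof. by apply: fin; rewrite gtr0_norm//; have := e0; lra. Qed.

Let fNh : (mgf mu Y Z (- (e / 2)) < +oo)%E.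
Proof. by apply: fin; rewrite normrN gtr0_norm//; have := e0; lra. Qed.

Let mi n : mu.-integrable setT (fun w => (Y w ^+ n * expR (Z w))%:E).
Proof. exact: tilted_moment_integrable fh fNh n. Qed.

Let series_gamma x : `|b * x| < 1 ->
  pseries (fun n => K * gbinom a n * b ^+ n) x @ \oo
    --> K * (1 - b * x) `^ (- a).
Proof.
move=> bx; rewrite (_ : pseries _ _ = (fun N => K * pseries (gbinom a) (b * x) N)).
  by apply: cvgMr; exact: binomial_series.
apply/funext => N; rewrite /pseries /series /= mulr_sumr.
by apply: eq_bigr => k _; rewrite exprMn; ring.
Qed.

Let momentE n : tilted_moment mu Y Z n / n`!%:R = K * gbinom a n * b ^+ n.
Proof.
(* Below [r] both series converge to the same function: the moment series by finiteness at [e / 2]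
   and [- (e / 2)], the binomial series because [|b * x| < 1]. *)
pose r := Num.min (e / 2) (1 / (`|b| + 1)).
have r0 : 0 < r by rewrite lt_min h0/= divr_gt0// ltr_wpDl.
apply/eqP; rewrite -subr_eq0; apply/eqP.
pose c n := tilted_moment mu Y Z n / n`!%:R - K * gbinom a n * b ^+ n.
apply: (@pseries_eq0 _ c _ r0) => x /andP[_]; rewrite lt_min => /andP[x1 x2].
have bx : `|b * x| < 1.
  move: x2; rewrite ltr_pdivlMr ?ltr_wpDl// normrM.
  by have := normr_ge0 x; nra.
have xh : `|x| <= e / 2 by exact: ltW.
have := mgf_series mY mZ h0 fh fNh xh.
rewrite mgfE/=; last by apply: lt_trans x1 _; have := e0; lra.
move=> /cvgB/(_ (series_gamma bx)); rewrite subrr => L.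
rewrite (_ : pseries c x =
    (fun N => pseries (fun n => tilted_moment mu Y Z n / n`!%:R) x N
            - pseries (fun n => K * gbinom a n * b ^+ n) x N)); first exact: L.
apply/funext => N; rewrite /pseries /series /= -sumrB.
by apply: eq_bigr => k _; rewrite /c mulrBl.
Qed.

Let momentF : (fun n => tilted_moment mu Y Z n / n`!%:R)
  = (fun n => K * gbinom a n * b ^+ n).
Proof. by apply/funext => n; exact: momentE. Qed.

(* The Taylor coefficients at 0 are known, so Fatou's lemma applied to the even
   partial sums makes [mgf] finite on the whole disc of the binomial series. *)
Lemma gamma_mgf_disc x : `|b * x| < 1 ->
  mgf mu Y Z x = (K * (1 - b * x) `^ (- a))%:E.
Proof.
move=> bx.
have bNx : `|b * - x| < 1 by rewrite mulrN normrN.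
pose f (t : R) N w := (\sum_(0 <= k < N) (t * Y w) ^+ k / k`!%:R) * expR (Z w).
have mf t N : measurable_fun setT (f t N).
  apply: measurable_funM; last exact: measurableT_comp.
  apply: measurable_sum => k; apply: measurable_funM => //.
  by apply: measurable_funX; apply: measurable_funM.
have cf (t : R) w : f t ^~ w @ \oo --> expR (t * Y w + Z w).
  by rewrite expRD; apply: cvgMl; exact: is_cvg_series_exp_coeff.
(* Odd powers cancel and even ones are nonnegative, as Fatou's lemma requires; a single partial sum
   may be negative. The limit bounds the transform at [x] and at [- x] together. *)
pose g N w := f x N w + f (- x) N w.
have g0 N w : 0 <= g N w.
  rewrite /g -mulrDl mulr_ge0 ?expR_ge0// -big_split/= sumr_ge0// => k _.
  rewrite -mulrDl divr_ge0// mulNr.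
  have [ok|ek] := boolP (odd k); first by rewrite exprNn -signr_odd ok expr1 mulN1r subrr.
  by rewrite addr_ge0// real_exprn_even_ge0// num_real.
have := fatou mu measurableT
  (fun N => (@measurable_EFinP _ _ _ _ _).2 (measurable_funD (mf x N) (mf (- x) N)))
  (fun N w _ => g0 N w).
rewrite (_ : (fun N => (\int[mu]_w (g N w)%:E)%E) = (fun N =>
   (pseries (fun n => K * gbinom a n * b ^+ n) x N
   + pseries (fun n => K * gbinom a n * b ^+ n) (- x) N)%:E)); last first.
  apply/funext => N; rewrite -momentF EFinD -!integral_exp_partial//.
  rewrite -integralD//; exact: exp_partial_integrable.
have L : (fun N => (pseries (fun n => K * gbinom a n * b ^+ n) x N
   + pseries (fun n => K * gbinom a n * b ^+ n) (- x) N)%:E) @ \oo -->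
   (K * (1 - b * x) `^ (- a) + K * (1 - b * - x) `^ (- a))%:E.
  by apply: cvg_EFin; [exact: nearW|apply: cvgD; exact: series_gamma].
rewrite (is_cvg_limn_einfE (cvgP _ L)) (cvg_lim _ L)//.
under eq_integral => w _.
  rewrite (_ : limn_einf _ = (expR (x * Y w + Z w) + expR (- x * Y w + Z w))%:E).
    over.
  have Lw : (fun N => (g N w)%:E) @ \oo
      --> (expR (x * Y w + Z w) + expR (- x * Y w + Z w))%:E.
    by apply: cvg_EFin; [exact: nearW|apply: cvgD; exact: cf].
  by rewrite (is_cvg_limn_einfE (cvgP _ Lw)) (cvg_lim _ Lw).
move=> I.
have fx : (mgf mu Y Z x < +oo)%E.
  apply: le_lt_trans (le_lt_trans I (ltry _)); apply: le_integral_EFin => //.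
  - exact: measurable_expR_affine.
  - by apply: measurable_funD; exact: measurable_expR_affine.
  - by move=> w; rewrite lerDl expR_ge0.
have fNx : (mgf mu Y Z (- x) < +oo)%E.
  apply: le_lt_trans (le_lt_trans I (ltry _)); apply: le_integral_EFin => //.
  - exact: measurable_expR_affine.
  - by apply: measurable_funD; exact: measurable_expR_affine.
  - by move=> w; rewrite lerDr expR_ge0.
have [->|x0] := eqVneq x 0; first by rewrite mgfE// normr0.
have xx : 0 < `|x| by rewrite normr_gt0.
have f1 : (mgf mu Y Z `|x| < +oo)%E by case: (ger0P x).
have f2 : (mgf mu Y Z (- `|x|) < +oo)%E by case: (ger0P x); rewrite ?opprK.
rewrite -(fineK (mgf_fin_num mY mZ f1 f2 (lexx _))); congr EFin.
have := mgf_series mY mZ xx f1 f2 (lexx _); rewrite momentF => L1.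
exact: cvg_unique L1 (series_gamma bx).
Qed.

End gamma_mgf.

Lemma expR_segment_le (R : realType) (t u v : R) : 0 <= t <= 1 ->
  expR (u + t * (v - u)) <= expR u + expR v.
Proof.
move=> /andP[t0 t1]; have [uv|vu] := leP u v.
  apply: (@le_trans _ _ (expR v)); last by rewrite lerDr expR_ge0.
  by rewrite ler_expR; nra.
apply: (@le_trans _ _ (expR u)); last by rewrite lerDl expR_ge0.
by rewrite ler_expR; nra.
Qed.

Section gamma_mgf_line.
Context (R : realType) d (T : measurableType d).
Variables (mu : {measure set T -> \bar R}) (Y Z : T -> R).
Hypotheses (mY : measurable_fun setT Y) (mZ : measurable_fun setT Z).
Variables (A B a : R).
Hypothesis a0 : 0 < a.

Let gamma_at x := mgf mu Y Z x = ((A + B * x) `^ (- a))%:E.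

Let gamma_near x0 := exists2 e, 0 < e &
  forall x, `|x - x0| < e -> 0 < A + B * x /\ gamma_at x.

(** Recentring at [x0] puts [x0 * Y] into the tilt and turns [A + B * x] into [A0' * (1 - b * t)]
    with [b = - B / A0']. The disc [|b * t| < 1] is then exactly the stated interval. *)
Let gamma_step x0 x : gamma_near x0 ->
  0 < A + B * x < 2 * (A + B * x0) -> gamma_at x.
Proof.
move=> [e e0 H] /andP[Bx0 Bx2].
have [A0 _] : 0 < A + B * x0 /\ gamma_at x0 by apply: H; rewrite subrr normr0.
set A0' := A + B * x0 in A0 Bx2.
pose Z' w := x0 * Y w + Z w.
have mZ' : measurable_fun setT Z' by apply: measurable_funD => //; exact: measurable_funM.
have shift t : mgf mu Y Z' t = mgf mu Y Z (x0 + t).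
  by apply: eq_integral => w _; rewrite /Z' mulrDl addrA (addrC (t * _)).
have factor t : A + B * (x0 + t) = A0' * (1 - (- B / A0') * t).
  by rewrite /A0'; field; rewrite gt_eqF.
have := @gamma_mgf_disc _ _ _ mu Y Z' mY mZ' (A0' `^ (- a)) (- B / A0') a e a0 e0.
move=> /(_ _ (x - x0)); rewrite shift subrKC /gamma_at => ->.
- rewrite -powRM ?(ltW A0)//.
    by rewrite -factor subrKC.
  by rewrite -(pmulr_rge0 _ A0) -factor subrKC ltW.
- move=> t te; rewrite shift.
  have [] := H (x0 + t); first by rewrite addrAC subrr add0r.
  move=> p ->; rewrite factor powRM ?(ltW A0)//.
  by rewrite -(pmulr_rge0 _ A0) -factor ltW.
- have -> : - B / A0' * (x - x0) = - (B * (x - x0)) / A0' by ring.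
  rewrite normrM normrN normfV (gtr0_norm A0) ltr_pdivrMr// mul1r.
  by rewrite ltr_norml /A0'; apply/andP; split; move: Bx0 Bx2; rewrite /A0'; lra.
Qed.

(** Values of [A + B * x] below twice the central one need a single step; larger ones require a new
    centre [x1]. The factor is 3/2 rather than 2 so that [x1] lies strictly inside the disc and a
    whole neighbourhood of it is reached, as [gamma_near] demands. *)
Let gamma_iter n : forall x0 x, gamma_near x0 ->
  0 < A + B * x < 2 * (3 / 2) ^+ n * (A + B * x0) -> gamma_at x.
Proof.
elim: n => [|n IH] x0 x N0.
  by rewrite expr0 mulr1; exact: gamma_step.
move=> /andP[Bx0 Bxn].
have [A0 _] : 0 < A + B * x0 /\ gamma_at x0.
  by case: N0 => e e0; apply; rewrite subrr normr0.
have [Bx2|Bx2] := ltP (A + B * x) (2 * (A + B * x0)).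
  by apply: gamma_step N0 _; rewrite Bx0.
pose t := (A + B * x0) / 2 / (A + B * x - (A + B * x0)).
pose x1 := x0 + t * (x - x0).
have D0 : 0 < A + B * x - (A + B * x0) by lra.
have A1 : A + B * x1 = 3 / 2 * (A + B * x0).
  by rewrite /x1 /t; field; rewrite gt_eqF.
apply: (IH x1 x); last by rewrite Bx0 A1 (lt_le_trans Bxn)// exprS; lra.
have B1 : 0 < `|B| + 1 by rewrite ltr_wpDl.
exists ((A + B * x0) / 2 / (`|B| + 1)); first by rewrite !divr_gt0.
move=> y; rewrite ltr_pdivlMr// => yx1.
have : `|B * (y - x1)| < (A + B * x0) / 2.
  by apply: le_lt_trans yx1; rewrite normrM mulrC ler_wpM2l// lerDl.
rewrite ltr_norml => /andP[l1 l2].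
have E : A + B * y = A + B * x1 + B * (y - x1) by ring.
have p : 0 < A + B * y by rewrite E A1; lra.
by split => //; apply: gamma_step N0 _; rewrite p/= E A1; lra.
Qed.

Lemma gamma_mgf_line x0 x : gamma_near x0 -> 0 < A + B * x -> gamma_at x.
Proof.
move=> N0 Bx.
have [A0 _] : 0 < A + B * x0 /\ gamma_at x0.
  by case: N0 => e e0; apply; rewrite subrr normr0.
have bern n : n%:R / 2 <= (3 / 2) ^+ n :> R.
  elim: n => [|n IH]; first by rewrite mul0r.
  have : 1 <= (3 / 2 : R) ^+ n by apply: exprn_ege1; lra.
  by rewrite exprS -[n.+1%:R]natr1; lra.
pose n := (Num.truncn ((A + B * x) / (A + B * x0))).+1.
apply: (gamma_iter (n := n)) N0 _; rewrite Bx/=.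
have : (A + B * x) / (A + B * x0) < n%:R by exact: truncnS_gt.
rewrite ltr_pdivrMr// => /lt_le_trans; apply.
by rewrite ler_pM2r//; have := bern n; lra.
Qed.

(* [A + B * x] cannot vanish on the way, for [(A + B * x) `^ (- a)] would
   blow up there while [mgf] is bounded between two points where it is finite. *)
Lemma gamma_mgf_segment x0 x : gamma_near x0 ->
  (forall t, 0 <= t <= 1 -> 0 < A + B * (x0 + t * (x - x0)) \/
    (mgf mu Y Z (x0 + t * (x - x0)) < +oo)%E) ->
  0 < A + B * x /\ gamma_at x.
Proof.
move=> N0 H; have [Bx|Bx] := ltP 0 (A + B * x).
  by split => //; exact: (gamma_mgf_line N0 Bx).
exfalso.
have [A0 g0] : 0 < A + B * x0 /\ gamma_at x0.
  by case: N0 => e e0; apply; rewrite subrr normr0.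
set A0' := A + B * x0 in A0 g0.
pose t := A0' / (A0' - (A + B * x)).
have D0 : 0 < A0' - (A + B * x) by lra.
have t01 : 0 <= t <= 1.
  by rewrite /t divr_ge0 ?(ltW A0) ?(ltW D0)//= ler_pdivrMr//; lra.
pose y := x0 + t * (x - x0).
have By : A + B * y = 0.
  rewrite /y /t; move: D0; rewrite /A0' => D0; field.
  by rewrite gt_eqF.
have fy : (mgf mu Y Z y < +oo)%E.
  by have [|//] := H t t01; rewrite -/y By ltxx.
have fy' : mgf mu Y Z y \is a fin_num by rewrite ge0_fin_numE// mgf_ge0.
pose M := A0' `^ (- a) + fine (mgf mu Y Z y).
have M0 : 0 <= M by rewrite addr_ge0 ?powR_ge0// fine_ge0// mgf_ge0.
have M1 : 0 < M + 1 by rewrite ltr_wpDl.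
pose s := Num.min (A0' / 2) ((M + 1) `^ (- a^-1)).
have s0 : 0 < s by rewrite lt_min divr_gt0//= powR_gt0.
have sA : s <= A0' / 2 by rewrite ge_min lexx.
pose u := 1 - s / A0'.
have u01 : 0 <= u <= 1.
  rewrite /u subr_ge0 ler_pdivrMr// mul1r gerBl divr_ge0 ?(ltW s0) ?(ltW A0)//.
  by rewrite andbT; lra.
pose z := x0 + u * (y - x0).
have Bz : A + B * z = s.
  have -> : A + B * z = A0' + u * (A + B * y - A0') by rewrite /z /A0'; ring.
  by rewrite By /u; field; rewrite gt_eqF.
have gz : gamma_at z by apply: gamma_mgf_line N0 _; rewrite Bz.
have : (mgf mu Y Z z <= M%:E)%E.
  rewrite EFinD fineK// -g0.
  rewrite -ge0_integralD//; last 2 first.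
    by apply/measurable_EFinP; exact: measurable_expR_affine.
    by apply/measurable_EFinP; exact: measurable_expR_affine.
  apply: le_integral_EFin => //.
  - exact: measurable_expR_affine.
  - by apply: measurable_funD; exact: measurable_expR_affine.
  - move=> w; apply: le_trans (expR_segment_le _ _ u01).
    by rewrite ler_expR /z; lra.
rewrite gz Bz lee_fin; apply/negP; rewrite -ltNge.
apply: (@lt_le_trans _ _ (M + 1)); first by rewrite ltrDl.
rewrite powRN -[leLHS]invrK lef_pV2 ?posrE ?powR_gt0 ?invr_gt0//.
have -> : (M + 1)^-1 = ((M + 1) `^ (- a^-1)) `^ a.
  by rewrite -powRrM mulNr mulVf ?gt_eqF// powR_inv1// ltW.
by apply: ge0_ler_powR; rewrite ?nnegrE ?(ltW a0) ?(ltW s0) ?powR_ge0// ge_min lexx orbT.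
Qed.

End gamma_mgf_line.

(** * Propagation to the orthant *)

Definition row_set (R : realType) (n : nat) (th : 'rV[R]_n) (i : 'I_n) (s : R)
    : 'rV[R]_n :=
  \row_j (if j == i then s else th 0 j).

Definition affine_in_each (R : realType) (n : nat) (Q : 'rV[R]_n -> R) : Prop :=
  forall th i, exists A B : R, forall s, Q (row_set th i s) = A + B * s.

Section multigamma_laplace.
Context (R : realType) d (T : measurableType d) (n : nat).
Variables (mu : probability T R) (X : n.-tuple (T -> R)).
Hypothesis mX : forall i, measurable_fun setT (tnth X i).
Variables (Q : 'rV[R]_n -> R) (a : R).
Hypotheses (a0 : 0 < a) (affQ : affine_in_each Q).

Definition laplace (th : 'rV[R]_n) : \bar R :=
  (\int[mu]_w (expR (- \sum_(i < n) th 0%R i * tnth X i w))%:E)%E.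

Let gamma_at th := 0 < Q th /\ laplace th = (Q th `^ (- a))%:E.

Let measurable_sumX (th : 'rV[R]_n) :
  measurable_fun setT (fun w => \sum_(i < n) th 0%R i * tnth X i w).
Proof. by apply: measurable_sum => i; apply: measurable_funM. Qed.

Let measurable_laplace (th : 'rV[R]_n) :
  measurable_fun setT (fun w => expR (- \sum_(i < n) th 0%R i * tnth X i w)).
Proof.
by apply: measurableT_comp => //; apply: measurable_funN; exact: measurable_sumX.
Qed.

(** The coordinates of index below [m] have already moved into [K], the others are still near [c].
    While coordinate [m] is within [e] of [c], the induction hypothesis applies, which gives the
    starting neighbourhood on the line. Convexity of [K] keeps the segment inside the set where the
    last hypothesis offers either positivity of [Q] or finiteness. *)
Let gamma_swap (c : 'rV[R]_n) (e : R) (K : 'I_n -> R -> Prop) : 0 < e ->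
  (forall th : 'rV[R]_n, (forall i, `|th 0 i - c 0 i| < e) -> gamma_at th) ->
  (forall i s t u, K i s -> K i t -> 0 <= u <= 1 -> K i (s + u * (t - s))) ->
  (forall i s, `|s - c 0 i| < e -> K i s) ->
  (forall th : 'rV[R]_n, (forall i, K i (th 0 i)) -> 0 < Q th \/ (laplace th < +oo)%E) ->
  forall th : 'rV[R]_n, (forall i, K i (th 0 i)) -> gamma_at th.
Proof.
move=> e0 Hc convK cK HK.
suff H m (th : 'rV[R]_n) : (forall i : 'I_n, (i < m)%N -> K i (th 0 i)) ->
    (forall i : 'I_n, (m <= i)%N -> `|th 0 i - c 0 i| < e) -> gamma_at th.
  move=> th Kth; apply: (H n) => // i; first by rewrite leqNgt ltn_ord.
elim: m th => [|m IH] th H1 H2; first by apply: Hc => i; exact: H2.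
have [mn|nm] := ltnP m n; last first.
  apply: IH => i im; first by apply: H1; rewrite ltnS ltnW.
  by have := leq_trans nm im; rewrite leqNgt ltn_ord.
pose i0 := Ordinal mn.
have [A [B AB]] := affQ th i0.
pose Y w := - tnth X i0 w.
pose Z w := - \sum_(i < n) row_set th i0 0 0 i * tnth X i w.
have mY : measurable_fun setT Y by exact: measurable_funN.
have mZ : measurable_fun setT Z.
  by apply: measurable_funN; exact: measurable_sumX.
have LE s : laplace (row_set th i0 s) = mgf mu Y Z s.
  apply: eq_integral => w _; congr (expR _)%:E.
  rewrite /Z (bigD1 i0)//= [X in _ = _ - X](bigD1 i0)//= !mxE eqxx mul0r add0r.
  rewrite opprD /Y mulrN; congr (_ - _).
  by apply: eq_bigr => i ii0; rewrite !mxE (negbTE ii0).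
have near0 s : `|s - c 0 i0| < e -> gamma_at (row_set th i0 s).
  move=> sc; apply: IH => i; rewrite mxE; case: eqP => [-> _|ii0 im].
  - exact: cK.
  - by apply: H1; rewrite ltnS ltnW.
  - by [].
  - apply: H2; rewrite ltn_neqAle im andbT; apply/eqP => E; apply: ii0.
    exact: val_inj.
have thE : row_set th i0 (th 0 i0) = th.
  by apply/rowP => j; rewrite mxE; case: eqP => [->|].
have [] := @gamma_mgf_segment _ _ _ mu Y Z mY mZ A B a a0 (c 0 i0) (th 0 i0).
- exists e => // s /near0[Qs Ls]; rewrite -AB; split => //.
  by rewrite -LE Ls.
- move=> t t01; rewrite -AB -LE; apply: HK => i; rewrite mxE.
  case: eqP => [->|ii0].
    apply: convK => //; first by apply: cK; rewrite subrr normr0.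
    exact: H1.
  have [im|mi] := ltnP i m; first by apply: H1; rewrite ltnS ltnW.
  apply: cK; apply: H2; rewrite ltn_neqAle mi andbT; apply/eqP => E; apply: ii0.
  exact: val_inj.
- by rewrite -AB thE => Q0; rewrite -LE thE.
Qed.

(** Convexity of the exponential between [th] and 0, where the integrand is the constant 1,
    integrable under a probability. *)
Let laplace_scale (t : R) (th : 'rV[R]_n) : 0 <= t <= 1 ->
  (laplace th < +oo)%E -> (laplace (t *: th) < +oo)%E.
Proof.
move=> t01 fth.
apply: (@le_lt_trans _ _ (\int[mu]_w (1 + expR (- \sum_(i < n) th 0%R i * tnth X i w))%:E)%E).
  apply: le_integral_EFin => //.
  - by apply: measurable_funD => //; exact: measurable_laplace.
  move=> w; rewrite -[in leRHS]expR0; apply: le_trans (expR_segment_le _ _ t01).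
  rewrite ler_expR add0r subr0 mulrN mulr_sumr.
  by under eq_bigr => i _ do rewrite mxE -mulrA.
under eq_integral do rewrite EFinD.
rewrite ge0_integralD//; last by apply/measurable_EFinP; exact: measurable_laplace.
apply: lte_add_pinfty => //.
by rewrite integral_cst//= mul1e (le_lt_trans (probability_le1 mu measurableT))// ltry.
Qed.

Lemma multigamma_laplace (ep : R) : 0 < ep ->
  (forall th : 'rV[R]_n, (forall i, - ep <= th 0 i) -> 0 < Q th) ->
  multigamma Q a mu X ->
  forall th : 'rV[R]_n, (forall i, - ep <= th 0 i) -> laplace th = (Q th `^ (- a))%:E.
Proof.
move=> ep0 Qep; rewrite /multigamma gt_eqF// => -[U [u /nbhs_ballP[r /= r0 rU]] HU].
have HU' (th : 'rV[R]_n) : (forall i, `|th 0 i - u 0 i| < r) -> gamma_at th.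
  move=> H; have /HU[Q0 E] : U th.
    by apply: rU; split => // i j; rewrite ord1 /ball/= distrC; exact: H.
  by split => //; rewrite -E unlock.
pose M := \sum_i `|u 0 i|.
have M0 : 0 <= M by apply: sumr_ge0.
have uM i : `|u 0 i| <= M.
  by rewrite /M (bigD1 i)//= lerDl sumr_ge0.
(* The bound [(1 - q) * M <= r / 2] controls the shift of the centre in every coordinate, and
   [1 / 2 <= q] lets a ball of half the old radius fit into the new box. *)
pose q := 1 - r / (2 * (M + r)).
have Mr : 0 < M + r by rewrite ltr_wpDl.
have q12 : 1 / 2 <= q < 1.
  rewrite /q gtrBl divr_gt0 ?mulr_gt0// andbT lerBrDl -lerBrDr.
  by rewrite ler_pdivrMr ?mulr_gt0//; lra.
have q0 : 0 < q by lra.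
have q1 : (1 - q) * M <= r / 2.
  rewrite /q opprB addrC subrK mulrAC ler_pdivrMr ?mulr_gt0//; nra.
(* the box of radius [r] around [u] shrunk by the factor [q ^+ k] towards 0;
   [q] is close enough to 1 for consecutive boxes to overlap around centres *)
have stairs k (th : 'rV[R]_n) :
    (forall i, `|th 0 i - q ^+ k * u 0 i| < q ^+ k * r) -> gamma_at th.
  elim: k th => [|k IH].
    by move=> th H; apply: HU' => i; have := H i; rewrite expr0 !mul1r.
  pose t := q ^+ k; have t0 : 0 < t by rewrite exprn_gt0.
  have tE : q ^+ k.+1 = q * t by rewrite exprS.
  have t1 : 0 <= q ^+ k.+1 <= 1.
    by rewrite exprn_ge0 ?(ltW q0)//= exprn_ile1 ?(ltW q0)//; lra.
  have qk0 : 0 < q ^+ k.+1 by rewrite exprn_gt0.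
  apply: (@gamma_swap (q ^+ k.+1 *: u) (t * r / 2)
      (fun i s => `|s - q ^+ k.+1 * u 0 i| < q ^+ k.+1 * r)).
  - by rewrite divr_gt0// mulr_gt0.
  - move=> th H; apply: IH => i; rewrite -/t.
    have := H i; rewrite mxE tE => Hi.
    have -> : th 0 i - t * u 0 i =
        (th 0 i - q * t * u 0 i) + - ((1 - q) * u 0 i) * t by ring.
    apply: le_lt_trans (ler_normD _ _) _.
    have : `|- ((1 - q) * u 0 i) * t| <= r / 2 * t.
      rewrite normrM normrN (gtr0_norm t0) ler_pM2r//.
      apply: le_trans q1; rewrite normrM gtr0_norm ?subr_gt0; last by lra.
      by rewrite ler_pM2l// subr_gt0; lra.
    by move: Hi; lra.
  - move=> i x y v; rewrite !ltr_norml => /andP[x1 x2] /andP[y1 y2] /andP[v0 v1].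
    have [xy|yx] := leP x y.
      have l1 : x <= x + v * (y - x) by nra.
      have l2 : x + v * (y - x) <= y by nra.
      by apply/andP; split; lra.
    have l1 : y <= x + v * (y - x) by nra.
    have l2 : x + v * (y - x) <= x by nra.
    by apply/andP; split; lra.
  - move=> i s; rewrite mxE => /lt_le_trans; apply; rewrite tE.
    have : 0 < t * r by rewrite mulr_gt0.
    by nra.
  (* The sign of [Q] is unknown here, but a point of the shrunken box is a multiple, by a factor in
     [0, 1], of a point of the initial box, where the transform is finite. *)
  - move=> th H; right.
    have -> : th = q ^+ k.+1 *: ((q ^+ k.+1)^-1 *: th).
      by rewrite scalerA mulfV ?gt_eqF// scale1r.
    apply: laplace_scale => //.
    suff [_ ->] : gamma_at ((q ^+ k.+1)^-1 *: th) by rewrite ltry.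
    apply: HU' => i; rewrite mxE -(ltr_pM2l qk0).
    apply: le_lt_trans (H i); rewrite -[leLHS]/(_ * _).
    rewrite -{1}(gtr0_norm qk0) -normrM mulrBr mulrA mulfV ?gt_eqF// mul1r.
    by [].
(* The last box has coordinates above [- q ^+ k * (M + r)], so it lies in the region where [Q] is
   known to be positive. *)
have [k kep] : exists k, q ^+ k * (M + r) <= ep.
  have q1' : `|q| < 1 by rewrite gtr0_norm//; case/andP: q12.
  have /cvgrPdist_lt/(_ (ep / (M + r))) := cvg_expr q1'.
  case; first by rewrite divr_gt0.
  move=> k _ /(_ k (leqnn _)) /=; rewrite sub0r normrN => H; exists k.
  rewrite -ler_pdivlMr//; apply: le_trans (ltW H); exact: ler_norm.
have qk0 : 0 < q ^+ k by rewrite exprn_gt0.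
move=> th Hth.
suff [] : gamma_at th by [].
apply: (@gamma_swap (q ^+ k *: u) (q ^+ k * r) (fun=> fun s => - ep <= s)) => //.
- by rewrite mulr_gt0.
- by move=> th' H; apply: (stairs k) => i; have := H i; rewrite mxE.
- by move=> _ x y v x1 y1 /andP[v0 v1]; nra.
- move=> i s; rewrite mxE ltr_norml => /andP[s1 _].
  have := uM i; rewrite ler_norml => /andP[u1 _].
  have : q ^+ k * (- M) <= q ^+ k * u 0 i by rewrite ler_pM2l.
  by lra.
- by move=> th' H; left; exact: Qep.
Qed.

End multigamma_laplace.

(** * Uniqueness of Laplace transforms *)

Section weighted_law.
Context (R : realType) d d' (T : measurableType d) (T' : measurableType d').
Variables (mu : {measure set T -> \bar R}) (f : T -> R) (X : T -> T').
Hypotheses (mf : measurable_fun setT f) (f0 : forall t, 0 <= f t).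
Hypothesis (mX : measurable_fun setT X).

Let nu (B : set T') : \bar R := (\int[mu]_(t in X @^-1` B) (f t)%:E)%E.

Let nu0 : nu set0 = 0%E.
Proof. by rewrite /nu preimage_set0 integral_set0. Qed.

Let nu_ge0 B : (0 <= nu B)%E.
Proof. by apply: integral_ge0 => t _; rewrite lee_fin. Qed.

Let mXB B : measurable B -> measurable (X @^-1` B).
Proof. by move=> mB; rewrite -[X in measurable X]setTI; exact: mX. Qed.

Let nu_sigma_additive : semi_sigma_additive nu.
Proof.
move=> F mF tF mUF.
rewrite /nu preimage_bigcup ge0_integral_bigcup//.
- apply: is_cvg_ereal_nneg_natsum => n _; exact: nu_ge0.
- by move=> k; exact: mXB.
- by apply: measurable_funTS; exact/measurable_EFinP.
- by move=> x _; rewrite lee_fin.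
- apply/trivIsetP => /= i j _ _ ij; rewrite -preimage_setI.
  by move/trivIsetP : tF => /(_ _ _ _ _ ij) ->//; rewrite preimage_set0.
Qed.

Import HBNNSimple.

Lemma weighted_law : exists2 m : {measure set T' -> \bar R},
  (forall B, m B = (\int[mu]_(t in X @^-1` B) (f t)%:E)%E) &
  (forall g : T' -> R, measurable_fun setT g -> (forall x, 0 <= g x) ->
    (\int[m]_x (g x)%:E = \int[mu]_t (g (X t) * f t)%:E)%E).
Proof.
pose mixin := isMeasure.Build _ _ _ nu nu0 nu_ge0 nu_sigma_additive.
pose m : {measure set T' -> \bar R} := HB.pack nu mixin.
exists m => // g mg g0.
have mG : measurable_fun setT (EFin \o g) by exact/measurable_EFinP.
pose s := nnsfun_approx measurableT mG.
have s_cvg x : (fun n => (s n x)%:E) @ \oo --> (g x)%:E.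
  by apply: (cvg_nnsfun_approx measurableT mG) => // y _; rewrite lee_fin.
have s_nd x : {homo (fun n => s n x) : p q / (p <= q)%N >-> p <= q}.
  by move=> p q pq; exact/lefP/(nd_nnsfun_approx measurableT mG).
have step n : (\int[m]_x (s n x)%:E = \int[mu]_t (s n (X t) * f t)%:E)%E.
  rewrite integral_nnsfun// patch_setT. rewrite sintegralE.
  transitivity (\int[mu]_t (\sum_(k \in range (s n))
      (k * \1_(s n @^-1` [set k]) (X t) * f t)%:E))%E; last first.
    apply: eq_integral => t _; rewrite fsumEFin//; congr EFin.
    by rewrite [in RHS]fimfunE -mulr_fsuml.
  rewrite ge0_integral_fsum//; last 2 first.
  - move=> k; apply/measurable_EFinP; apply: measurable_funM => //.
    apply: measurable_funM => //; exact: measurableT_comp.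
  - move=> k t _; rewrite EFinM mule_ge0 ?lee_fin//.
    by have := nnfun_muleindic_ge0 (s n) k (X t); rewrite lee_fin.
  apply: eq_fsbigr => k; rewrite inE => -[y _ <-].
  transitivity ((s n y)%:E * \int[mu]_t (\1_(s n @^-1` [set s n y]) (X t) * f t)%:E)%E.
    congr (_ * _)%E; rewrite /m/= /nu integral_mkcond; apply: eq_integral => t _.
    rewrite patchE indicE.
    have -> : (t \in X @^-1` (s n @^-1` [set s n y])) = (X t \in s n @^-1` [set s n y]).
      by [].
    by case: ifP; rewrite ?mul1r ?mul0r.
  rewrite -ge0_integralZl_EFin//.
  - by apply: eq_integral => t _; rewrite -EFinM mulrA.
  - by move=> t _; rewrite lee_fin mulr_ge0// indicE.
  - apply/measurable_EFinP; apply: measurable_funM => //; exact: measurableT_comp.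
transitivity (limn (fun n => \int[m]_x (s n x)%:E))%E.
  rewrite -monotone_convergence//.
  - by apply: eq_integral => x _; apply/esym/cvg_lim => //; exact: s_cvg.
  - by move=> n; exact/measurable_EFinP.
  - by move=> n x _; rewrite lee_fin.
  - by move=> x _ p q pq; rewrite lee_fin s_nd.
transitivity (limn (fun n => \int[mu]_t (s n (X t) * f t)%:E))%E.
  by congr (limn _); apply/funext => n; exact: step.
rewrite -monotone_convergence//.
- apply: eq_integral => t _; apply/cvg_lim => //.
  under eq_fun do rewrite EFinM; rewrite EFinM.
  by apply: cvgeZr => //; exact: s_cvg.
- move=> n; apply/measurable_EFinP; apply: measurable_funM => //; exact: measurableT_comp.
- by move=> n t _; rewrite lee_fin mulr_ge0.
- by move=> t _ p q pq; rewrite lee_fin ler_wpM2r// s_nd.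
Qed.

End weighted_law.

Lemma eq_weighted_law (R : realType) d d' (T : measurableType d)
    (T' : measurableType d') (mu : {measure set T -> \bar R}) (f g : T -> R)
    (X : T -> T') (h : T' -> R) :
  measurable_fun setT f -> (forall t, 0 <= f t) ->
  measurable_fun setT g -> (forall t, 0 <= g t) ->
  measurable_fun setT X -> measurable_fun setT h -> (forall x, 0 <= h x) ->
  (forall B, measurable B -> \int[mu]_(t in X @^-1` B) (f t)%:E
                           = \int[mu]_(t in X @^-1` B) (g t)%:E)%E ->
  (\int[mu]_t (h (X t) * f t)%:E = \int[mu]_t (h (X t) * g t)%:E)%E.
Proof.
move=> mf f0 mg g0 mX mh h0 fg.
have [m mE mint] := weighted_law mu mf f0 mX.
have [m' m'E m'int] := weighted_law mu mg g0 mX.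
rewrite -mint// -m'int//; apply: eq_measure_integral => B mB _.
by rewrite mE m'E fg.
Qed.

Lemma gbinom2 (R : realType) n : gbinom 2 n = n.+1%:R :> R.
Proof.
elim: n => [|n /= ->] //.
by rewrite -[n.+2%:R]natr1 -[n.+1%:R]natr1; field; rewrite natr1.
Qed.

(** The terms are dominated by [n.+1%:R * r ^+ n], the terms of the convergent binomial series of
    exponent 2. *)
Lemma cvg_natr_expr (R : realType) (r : R) : 0 <= r < 1 ->
  (fun n => n%:R * r ^+ n) @ \oo --> (0 : R).
Proof.
move=> /andP[r0 r1].
have r1' : `|r| < 1 by rewrite ger0_norm.
have /cvg_series_cvg_0 c0 := is_cvg_gbinom (ltr0Sn R 1) r1'.
apply: (squeeze_cvgr _ (cvg_cst 0) c0); apply: nearW => n.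
rewrite mulr_ge0 ?exprn_ge0//= gbinom2 ler_wpM2r ?exprn_ge0//.
by rewrite ler_nat.
Qed.

(* [n * 2 ^ n] instead of [2 ^ n] makes the limit 0, not [expR (-1)], at
   [y = 1 / 2]. *)
Lemma cvg_threshold (R : realType) (y : R) : 0 <= y <= 1 ->
  (fun n => (1 - y ^+ n) ^+ (n * 2 ^ n)%N) @ \oo --> ((y < 1 / 2)%R%:R : R).
Proof.
move=> /andP[y0 y1].
have y01 n : 0 <= 1 - y ^+ n <= 1.
  by rewrite subr_ge0 exprn_ile1//= gerBl exprn_ge0.
have kE n : (n * 2 ^ n)%N%:R * y ^+ n = n%:R * (2 * y) ^+ n.
  by rewrite natrM natrX exprMn mulrA.
have [y2|y2] := ltP y (1 / 2) => /=.
  have bern (t : R) k : 0 <= t <= 1 -> 1 - k%:R * t <= (1 - t) ^+ k.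
    move=> /andP[t0 t1]; elim: k => [|k IH]; first by rewrite mul0r subr0.
    rewrite exprS -natr1; have k0 : 0 <= k%:R :> R by [].
    by move: IH; set p := (1 - t) ^+ k; nra.
  have c : (fun n => 1 - n%:R * (2 * y) ^+ n) @ \oo --> (1 - 0 : R).
    apply: cvgB; first exact: cvg_cst.
    by apply: cvg_natr_expr; apply/andP; split; lra.
  rewrite subr0 in c; apply: (squeeze_cvgr _ c (cvg_cst (1 : R))).
  apply: nearW => n.
  have /andP[h0 h1] := y01 n; rewrite -kE; apply/andP; split.
    by apply: bern; rewrite exprn_ge0//= exprn_ile1.
  exact: exprn_ile1.
(* Here [1 - y ^+ n <= expR (- y ^+ n)], and [n * 2 ^ n * y ^+ n >= n] because [2 * y >= 1]. *)
apply: (squeeze_cvgr _ (cvg_cst 0) (@cvgn_expR R)); apply: nearW => n.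
have [h0 h1] := andP (y01 n); rewrite exprn_ge0//=.
apply: (@le_trans _ _ (expR (- (y ^+ n)) ^+ (n * 2 ^ n)%N)).
  by rewrite lerXn2r ?nnegrE ?expR_ge0// expR_ge1Dx.
rewrite -expRM_natl ler_expR mulrN lerN2 kE ler_peMr//.
by apply: exprn_ege1; lra.
Qed.

Lemma eq_integral_poly_horner (R : realType) d (T : measurableType d)
    (mu : {measure set T -> \bar R}) (f g y : T -> R) (p : {poly R}) :
  (forall n, mu.-integrable setT (fun t => (y t ^+ n * f t)%:E)) ->
  (forall n, mu.-integrable setT (fun t => (y t ^+ n * g t)%:E)) ->
  (forall n, \int[mu]_t (y t ^+ n * f t)%:E = \int[mu]_t (y t ^+ n * g t)%:E)%E ->
  (\int[mu]_t (p.[y t] * f t)%:E = \int[mu]_t (p.[y t] * g t)%:E)%E.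
Proof.
move=> yf yg fg.
have H (h : T -> R) : (forall n, mu.-integrable setT (fun t => (y t ^+ n * h t)%:E)) ->
    (\int[mu]_t (p.[y t] * h t)%:E =
     \sum_(i < size p) (p`_i)%:E * \int[mu]_t (y t ^+ i * h t)%:E)%E.
  move=> yh; transitivity (\sum_(i < size p)
      \int[mu]_t ((p`_i)%:E * (y t ^+ i * h t)%:E))%E.
    rewrite -integral_sum//; last by move=> i; exact: integrableZl.
    apply: eq_integral => t _; rewrite horner_coef mulr_suml -sumEFin.
    by apply: eq_bigr => i _; rewrite -EFinM mulrA.
  by apply: eq_bigr => i _; rewrite integralZl.
by rewrite !H//; apply: eq_bigr => i _; rewrite fg.
Qed.

Section laplace_unique.
Context (R : realType) d (T : measurableType d).
Variables (mu : {measure set T -> \bar R}) (X : T -> R).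
Hypotheses (mX : measurable_fun setT X) (X0 : {ae mu, forall t, 0 < X t}).

(** With [s = ln 2 / x], the condition [expR (- s * X t) < 1 / 2] means [x < X t]. The threshold
    polynomials in this exponential therefore tend almost everywhere to the indicator of [X > x],
    and their integrals involve the Laplace transform only at multiples of [s]. *)
Let above_cvg (f : T -> R) (x : R) : 0 < x ->
  measurable_fun setT f -> (forall t, 0 <= f t) ->
  mu.-integrable setT (fun t => (f t)%:E) ->
  (fun n => \int[mu]_t
     (((1 - 'X^n) ^+ (n * 2 ^ n)%N).[expR (- (ln 2 / x) * X t)] * f t)%:E)%E
  @ \oo --> (\int[mu]_(t in X @^-1` `]x, +oo[) (f t)%:E)%E.
Proof.
move=> x0 mf f0 fi.
pose y t := expR (- (ln 2 / x) * X t).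
have hE n t : ((1 - 'X^n) ^+ (n * 2 ^ n)%N).[y t] = (1 - y t ^+ n) ^+ (n * 2 ^ n)%N.
  by rewrite !hornerE.
have ln2 : 0 < ln 2 / x :> R by rewrite divr_gt0// ln_gt0// ltr1n.
have yX t : (y t < 1 / 2) = (x < X t).
  rewrite /y (_ : 1 / 2 = expR (- (ln 2 / x) * x)).
    by rewrite ltr_expR !mulNr ltrN2 ltr_pM2l.
  by rewrite mulNr divfK ?gt_eqF// expRN lnK ?posrE// div1r.
have y01 : {ae mu, forall t, 0 <= y t <= 1}.
  apply: filterS X0 => t Xt; rewrite expR_ge0/= expR_le1.
  by rewrite mulNr oppr_le0 mulr_ge0// ltW.
have my : measurable_fun setT y.
  by apply: measurableT_comp => //; exact: measurable_funM.
have mXx : measurable (X @^-1` `]x, +oo[).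
  by rewrite -[X in measurable X]setTI; exact: mX.
have := @dominated_convergence _ _ _ mu setT measurableT
  (fun n t => ((1 - y t ^+ n) ^+ (n * 2 ^ n)%N * f t)%:E)
  (fun t => (\1_(X @^-1` `]x, +oo[) t * f t)%:E) (fun t => (f t)%:E).
case=> //.
- move=> n; apply/measurable_EFinP; apply: measurable_funM => //.
  apply: measurable_funX; apply: measurable_funB => //; exact: measurable_funX.
- by apply/measurable_EFinP; apply: measurable_funM.
- apply: filterS y01 => t yt _; apply: cvg_EFin; first exact: nearW.
  apply: cvgMl; rewrite indicE.
  have -> : (t \in X @^-1` `]x, +oo[) = (y t < 1 / 2).
    by rewrite yX; apply/idP/idP; rewrite inE/= in_itv/= andbT.
  exact: cvg_threshold.
- apply: filterS y01 => t /andP[yt0 yt1] n _.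
  rewrite lee_fin normrM (ger0_norm (f0 t)) ler_piMl//.
  have h : 0 <= 1 - y t ^+ n by rewrite subr_ge0 exprn_ile1.
  by rewrite normrX exprn_ile1// ger0_norm// gerBl exprn_ge0.
move=> _ _.
rewrite (_ : (\int[mu]_t (\1__ t * f t)%:E)%E =
  (\int[mu]_(t in X @^-1` `]x, +oo[) (f t)%:E)%E); last first.
  rewrite [RHS]integral_mkcond; apply: eq_integral => t _.
  by rewrite patchE indicE; case: ifP; rewrite ?mul1r ?mul0r.
apply: cvg_trans; apply: near_eq_cvg; apply: nearW => n /=.
by apply: eq_integral => t _; rewrite hE.
Qed.

(** Powers of [expR (- s * X t)] are again Laplace kernels, so both densities give the same mass to
    [X > x] for each [x > 0]. For [x <= 0] that event has full measure and its mass is the transform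
    at 0. Half-lines generate the Borel sets. *)
Lemma laplace_unique (f g : T -> R) :
  measurable_fun setT f -> (forall t, 0 <= f t) ->
  measurable_fun setT g -> (forall t, 0 <= g t) ->
  (forall s : R, (0 <= s)%R -> \int[mu]_t (expR (- s * X t) * f t)%:E < +oo)%E ->
  (forall s : R, (0 <= s)%R -> \int[mu]_t (expR (- s * X t) * f t)%:E
                     = \int[mu]_t (expR (- s * X t) * g t)%:E)%E ->
  forall B, measurable B ->
  (\int[mu]_(t in X @^-1` B) (f t)%:E = \int[mu]_(t in X @^-1` B) (g t)%:E)%E.
Proof.
move=> mf f0 mg g0 ffin fg.
have mY s : measurable_fun setT (fun t => expR (- s * X t)).
  by apply: measurableT_comp => //; exact: measurable_funM.
have fint s : 0 <= s -> mu.-integrable setT (fun t => (expR (- s * X t) * f t)%:E).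
  move=> s0; apply: integrable_ge0; [exact: measurable_funM| |exact: ffin].
  by move=> t; rewrite mulr_ge0// expR_ge0.
have gint s : 0 <= s -> mu.-integrable setT (fun t => (expR (- s * X t) * g t)%:E).
  move=> s0; apply: integrable_ge0; [exact: measurable_funM| |].
    by move=> t; rewrite mulr_ge0// expR_ge0.
  by rewrite -fg// ffin.
have E0 (h : T -> R) t : expR (- 0 * X t) * h t = h t.
  by rewrite oppr0 mul0r expR0 mul1r.
have [m mE _] := weighted_law mu mf f0 mX.
have [m' m'E _] := weighted_law mu mg g0 mX.
move=> B mB; rewrite -mE -m'E.
have fi : mu.-integrable setT (fun t => (f t)%:E).
  by have := fint 0 (lexx _); under eq_fun do rewrite E0.
have gi : mu.-integrable setT (fun t => (g t)%:E).
  by have := gint 0 (lexx _); under eq_fun do rewrite E0.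
apply: (measure_unique (@RGenOInfty.G R) (fun k => `]- k%:R, +oo[%classic)) => //.
- exact: RGenOInfty.measurableE.
- move=> _ _ [x ->] [x' ->]; exists (Num.max x x').
  by apply/seteqP; split => z /=; rewrite !in_itv/= !andbT gt_max => /andP.
- by move=> k; exists (- k%:R).
- apply/seteqP; split => // x _; exists (Num.truncn `|x|).+1 => //=.
  rewrite in_itv/= andbT ltrNl; apply: le_lt_trans (truncnS_gt _).
  by rewrite -normrN ler_norm.
- move=> _ [x ->]; rewrite mE m'E.
  have mXx : measurable (X @^-1` `]x, +oo[).
    by rewrite -[X in measurable X]setTI; exact: mX.
  have [x0|x0] := ltP 0 x.
    have cf := above_cvg x0 mf f0 fi.
    have cg := above_cvg x0 mg g0 gi.
    suff E : (fun n => \int[mu]_t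
       (((1 - 'X^n) ^+ (n * 2 ^ n)%N).[expR (- (ln 2 / x) * X t)] * f t)%:E)%E =
      (fun n => \int[mu]_t
       (((1 - 'X^n) ^+ (n * 2 ^ n)%N).[expR (- (ln 2 / x) * X t)] * g t)%:E)%E.
      by rewrite E in cf; exact: cvg_unique cf cg.
    apply/funext => n; apply: eq_integral_poly_horner.
    + move=> k; have := fint (ln 2 / x * k%:R).
      rewrite mulr_ge0 ?divr_ge0 ?ln_ge0 ?ler1n ?(ltW x0)//.
      move=> /(_ isT); under eq_fun do rewrite -mulNr mulrAC expRM_natr.
      by [].
    + move=> k; have := gint (ln 2 / x * k%:R).
      rewrite mulr_ge0 ?divr_ge0 ?ln_ge0 ?ler1n ?(ltW x0)//.
      move=> /(_ isT); under eq_fun do rewrite -mulNr mulrAC expRM_natr.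
      by [].
    + move=> k; have := fg (ln 2 / x * k%:R); rewrite mulr_ge0 ?divr_ge0 ?ln_ge0 ?ler1n ?(ltW x0)//.
      move=> /(_ isT).
      under eq_integral do rewrite -mulNr mulrAC expRM_natr.
      by under [in X in _ = X -> _]eq_integral do rewrite -mulNr mulrAC expRM_natr.
  have full (h : T -> R) : measurable_fun setT h -> (forall t, 0 <= h t) ->
      (\int[mu]_(t in X @^-1` `]x, +oo[) (h t)%:E = \int[mu]_t (h t)%:E)%E.
    move=> mh h0; rewrite integral_mkcond; apply: ge0_ae_eq_integral => //.
    + by apply/(measurable_restrictT _ mXx).1; apply: measurable_funTS; exact/measurable_EFinP.
    + exact/measurable_EFinP.
    + by move=> t _; rewrite patchE; case: ifP; rewrite ?lee_fin.
    + by move=> t _; rewrite lee_fin.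
    + apply: filterS X0 => t Xt _; rewrite patchE mem_set//=.
      by rewrite in_itv/= andbT (le_lt_trans x0).
  rewrite !full//; have := fg 0 (lexx _).
  under eq_integral do rewrite E0.
  by under [in X in _ = X -> _]eq_integral do rewrite E0.
- move=> k; rewrite mE.
  apply: (@le_lt_trans _ _ (\int[mu]_t (f t)%:E)%E).
    apply: ge0_subset_integral => //.
      by rewrite -[X in measurable X]setTI; exact: mX.
    exact/measurable_EFinP.
    by move=> t _; rewrite lee_fin.
  rewrite (_ : integral _ _ _ = (\int[mu]_t (expR (- 0 * X t) * f t)%:E)%E).
    exact: ffin.
  by apply: eq_integral => t _; rewrite E0.
Qed.

End laplace_unique.

(** * Poisson mixtures *)

Lemma poisson1 (R : realType) (r : R) (n : nat) : 0 < r ->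
  poisson r [set n] = (r ^+ n / n`!%:R * expR (- r))%:E.
Proof.
move=> r0; rewrite /poisson /= /poisson_prob r0 esum_set1.
  by rewrite /poisson_pmf r0.
by rewrite lee_fin poisson_pmf_ge0.
Qed.

Lemma poisson_pgf (R : realType) (r z : R) :
  (\sum_(n <oo) (r ^+ n / n`!%:R * expR (- r) * z ^+ n)%:E
   = (expR (r * (z - 1)))%:E)%E.
Proof.
apply/cvg_lim => //.
rewrite (_ : (fun _ => _) = (fun N => (expR (- r) * series (exp_coeff (r * z)) N)%:E)).
  apply: cvg_EFin; first exact: nearW.
  rewrite (_ : r * (z - 1) = - r + r * z); last by ring.
  by rewrite expRD; apply: cvgMr; exact: is_cvg_series_exp_coeff.
apply/funext => N; rewrite sumEFin /series/= mulr_sumr.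
by congr EFin; apply: eq_bigr => k _; rewrite /exp_coeff/= exprMn; ring.
Qed.

(** Sums out the last component of a nested tuple, [c] being the value of its generating
    function. *)
Lemma esum_pair_nat (R : realType) (T : choiceType) (f : T -> R) (g : nat -> R) (c : R) :
  (forall i, 0 <= f i) -> (forall n, 0 <= g n) ->
  (\sum_(n <oo) (g n)%:E = c%:E)%E ->
  (\esum_(k in [set: T * nat]) (f k.1 * g k.2)%:E = \esum_(i in [set: T]) (f i * c)%:E)%E.
Proof.
move=> f0 g0 gc.
have <- : setT `*`` (fun=> setT) = [set: T * nat] by apply/seteqP; split.
rewrite -(@esum_esum _ _ _ _ _ (fun i n => (f i * g n)%:E))//; last first.
  by move=> i j _ _; rewrite lee_fin mulr_ge0.
apply: eq_esum => i _; rewrite -nneseries_esumT; last first.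
  by move=> n; rewrite lee_fin mulr_ge0.
under eq_eseriesr do rewrite EFinM.
by rewrite nneseriesZl// ?gc ?EFinM// => n _; rewrite lee_fin.
Qed.

(** Regrouping the negative powers by [v1], ..., [v5] separates the variables: the sum is a product
    of five Poisson generating functions, at the inverses of [s2], [s3], [s23], [s2 * s23] and
    [s3 * s23]. *)
Lemma poisson_mixture (R : realType) (lam r1 r2 r3 r4 r5 s2 s3 s23 : R) :
  0 < r1 -> 0 < r2 -> 0 < r3 -> 0 < r4 -> 0 < r5 ->
  0 < s2 -> 0 < s3 -> 0 < s23 ->
  ((\esum_(v in [set: nat * nat * nat * nat * nat])
     let '(v1, v2, v3, v4, v5) := v in
     poisson r1 [set v1] * poisson r2 [set v2] * poisson r3 [set v3]
     * poisson r4 [set v4] * poisson r5 [set v5]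
     * (s2 ^- (v1 + v4) * s3 ^- (v2 + v5)
        * s23 `^ (- (lam + (v3 + v4 + v5)%:R)))%:E)
   = (s23 `^ (- lam) * expR (r1 * (s2^-1 - 1) + r2 * (s3^-1 - 1)
        + r3 * (s23^-1 - 1) + r4 * (s2^-1 * s23^-1 - 1)
        + r5 * (s3^-1 * s23^-1 - 1)))%:E)%E.
Proof.
move=> r10 r20 r30 r40 r50 s20 s30 s230.
pose g (r z : R) (n : nat) := r ^+ n / n`!%:R * expR (- r) * z ^+ n.
have g0 r z n : 0 < r -> 0 < z -> 0 <= g r z n.
  by move=> r0 z0; rewrite !mulr_ge0 ?expR_ge0 ?exprn_ge0 ?invr_ge0 ?ltW.
have z20 : 0 < s2^-1 by rewrite invr_gt0.
have z30 : 0 < s3^-1 by rewrite invr_gt0.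
have z230 : 0 < s23^-1 by rewrite invr_gt0.
have z40 : 0 < s2^-1 * s23^-1 by rewrite mulr_gt0.
have z50 : 0 < s3^-1 * s23^-1 by rewrite mulr_gt0.
(* The factors follow the nesting of the tuple, so that the last one is always the next to be summed
   out; [f3] and [f2] below are the shorter products. *)
pose f4 (k : nat * nat * nat * nat) := s23 `^ (- lam) * g r1 s2^-1 k.1.1.1
  * g r2 s3^-1 k.1.1.2 * g r3 s23^-1 k.1.2 * g r4 (s2^-1 * s23^-1) k.2.
transitivity (\esum_(v in [set: nat * nat * nat * nat * nat])
   (f4 v.1 * g r5 (s3^-1 * s23^-1) v.2)%:E)%E.
  apply: eq_esum => -[[[[v1 v2] v3] v4] v5] _; rewrite !poisson1// -!EFinM.
  rewrite /f4 /g /=; congr EFin.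
  have -> : s23 `^ (- (lam + (v3 + v4 + v5)%:R)) =
      s23 `^ (- lam) * (s23^-1 ^+ v3 * s23^-1 ^+ v4 * s23^-1 ^+ v5).
    rewrite opprD powRD; last by rewrite (gt_eqF s230) implybT.
    by rewrite powR_invn ?(ltW s230)// -exprVn !exprD.
  rewrite -!exprVn !exprD !exprMn; ring.
pose E5 := expR (r5 * (s3^-1 * s23^-1 - 1)).
pose E4 := expR (r4 * (s2^-1 * s23^-1 - 1)).
pose E3 := expR (r3 * (s23^-1 - 1)).
pose E2 := expR (r2 * (s3^-1 - 1)).
pose E1 := expR (r1 * (s2^-1 - 1)).
pose f3 (k : nat * nat * nat) := s23 `^ (- lam) * g r1 s2^-1 k.1.1
  * g r2 s3^-1 k.1.2 * g r3 s23^-1 k.2.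
pose f2 (k : nat * nat) := s23 `^ (- lam) * g r1 s2^-1 k.1 * g r2 s3^-1 k.2.
have f20 k : 0 <= f2 k.
  by apply: mulr_ge0; [apply: mulr_ge0; [exact: powR_ge0|exact: g0]|exact: g0].
have f30 k : 0 <= f3 k by apply: mulr_ge0 (f20 k.1) _; exact: g0.
have f40 k : 0 <= f4 k by apply: mulr_ge0 (f30 k.1) _; exact: g0.
rewrite (esum_pair_nat f40 _ (poisson_pgf r5 _)) ?g0//; last by move=> n; exact: g0.
transitivity (\esum_(k in [set: nat * nat * nat * nat])
    (E5 * f3 k.1 * g r4 (s2^-1 * s23^-1) k.2)%:E)%E.
  by apply: eq_esum => k _; rewrite /f4 /f3 -/E5; congr EFin; ring.
rewrite (esum_pair_nat (f := fun k => E5 * f3 k) _ _ (poisson_pgf r4 _)); last 2 first.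
  - by move=> k; apply: mulr_ge0 => //; exact: expR_ge0.
  - by move=> n; exact: g0.
transitivity (\esum_(k in [set: nat * nat * nat])
    (E5 * E4 * f2 k.1 * g r3 s23^-1 k.2)%:E)%E.
  by apply: eq_esum => k _; rewrite /f3 /f2 -/E4; congr EFin; ring.
rewrite (esum_pair_nat (f := fun k => E5 * E4 * f2 k) _ _ (poisson_pgf r3 _)); last 2 first.
  - by move=> k; apply: mulr_ge0 => //; apply: mulr_ge0; exact: expR_ge0.
  - by move=> n; exact: g0.
transitivity (\esum_(k in [set: nat * nat])
    (E5 * E4 * E3 * s23 `^ (- lam) * g r1 s2^-1 k.1 * g r2 s3^-1 k.2)%:E)%E.
  by apply: eq_esum => k _; rewrite /f2 -/E3; congr EFin; ring.
rewrite (esum_pair_nat (f := fun k => E5 * E4 * E3 * s23 `^ (- lam) * g r1 s2^-1 k)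
  _ _ (poisson_pgf r2 _)); last 2 first.
  - move=> k; apply: mulr_ge0; last exact: g0.
    apply: mulr_ge0; last exact: powR_ge0.
    by apply: mulr_ge0; last exact: expR_ge0; apply: mulr_ge0; exact: expR_ge0.
  - by move=> n; exact: g0.
transitivity (\sum_(n <oo) ((E5 * E4 * E3 * s23 `^ (- lam) * E2)%:E * (g r1 s2^-1 n)%:E))%E.
  rewrite -nneseries_esumT.
    by apply: eq_eseriesr => n _; rewrite -EFinM -/E2; congr EFin; ring.
  move=> n; rewrite lee_fin; apply: mulr_ge0; last exact: expR_ge0.
  apply: mulr_ge0; last exact: g0.
  apply: mulr_ge0; last exact: powR_ge0.
  by apply: mulr_ge0; last exact: expR_ge0; apply: mulr_ge0; exact: expR_ge0.
rewrite nneseriesZl; last by move=> n _; rewrite lee_fin g0.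
rewrite poisson_pgf -EFinM; congr EFin.
by rewrite !expRD -/E1 /E1 /E2 /E3 /E4 /E5; ring.
Qed.

(* The subtracted term is the exponent [c] of the conditional transform
   [S23 `^ (- lam) * expR (x1 * c)] given by [poisson_mixture]. *)
Lemma mixture_factorization (R : realType)
    (p1 p2 p3 p12 p13 p23 p123 t1 t2 t3 : R) :
  0 < p1 -> 0 < p12 -> 0 < p13 -> 0 < p123 ->
  let b12 := p13 * p23 / p123 ^+ 2 - p3 / p123 in
  let b13 := p12 * p23 / p123 ^+ 2 - p2 / p123 in
  let b23 := p13 * p12 / p123 ^+ 2 - p1 / p123 in
  let b123 := - (1 / p123) + p23 * p1 / p123 ^+ 2 + p13 * p2 / p123 ^+ 2
    + p12 * p3 / p123 ^+ 2 - 2 * p23 * p13 * p12 / p123 ^+ 3 in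
  let S23 := 1 + p12 / p1 * t2 + p13 / p1 * t3 + p123 / p1 * t2 * t3 in
  let S2 := 1 + (p13 / p123)^-1 * t2 in
  let S3 := 1 + (p12 / p123)^-1 * t3 in
  S2 != 0 -> S3 != 0 -> S23 != 0 ->
  S23 * (1 + p1 * (t1 - (b12 / (p13 / p123) * (S2^-1 - 1)
     + b13 / (p12 / p123) * (S3^-1 - 1) + b123 / (p1 / p123) * (S23^-1 - 1)
     + b12 * b23 / (p13 / p123 * (p1 / p123)) * (S2^-1 * S23^-1 - 1)
     + b13 * b23 / (p12 / p123 * (p1 / p123)) * (S3^-1 * S23^-1 - 1)))) =
  1 + p1 * t1 + p2 * t2 + p3 * t3 + p12 * t1 * t2 + p13 * t1 * t3
      + p23 * t2 * t3 + p123 * t1 * t2 * t3.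
Proof.
move=> p10 p120 p130 p1230 b12 b13 b23 b123 S23 S2 S3 S20 S30 S230.
rewrite /b12 /b13 /b23 /b123.
have n1 : p1 != 0 by rewrite gt_eqF.
have n12 : p12 != 0 by rewrite gt_eqF.
have n13 : p13 != 0 by rewrite gt_eqF.
have n123 : p123 != 0 by rewrite gt_eqF.
have E2 : S2 = (p13 + p123 * t2) / p13 by rewrite /S2; field; rewrite n13 n123.
have E3 : S3 = (p12 + p123 * t3) / p12 by rewrite /S3; field; rewrite n12 n123.
have E23 : S23 = (p1 + p12 * t2 + p13 * t3 + p123 * t2 * t3) / p1.
  by rewrite /S23; field.
have d2 : p13 + p123 * t2 != 0.
  by apply: contraNneq S20 => E; rewrite E2 E mul0r.
have d3 : p12 + p123 * t3 != 0.
  by apply: contraNneq S30 => E; rewrite E3 E mul0r.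
have d23 : p1 + p12 * t2 + p13 * t3 + p123 * t2 * t3 != 0.
  by apply: contraNneq S230 => E; rewrite E23 E mul0r.
rewrite E2 E3 E23; field.
by rewrite n1 n12 n13 n123 d2 d3 d23.
Qed.

(** * Countable sums and conditioning on a discrete variable *)

Section countable_sum.
Context (R : realType) d (T : measurableType d) (D : choiceType).
Variables (e : D -> nat) (mu : {measure set T -> \bar R}).
Hypothesis e_inj : injective e.
Local Open Scope ereal_scope.

Let fiber n : (e @^-1` [set n] = set0) \/ (exists v, e @^-1` [set n] = [set v]).
Proof.
have [[v ev]|H] := pselect (exists v, e v = n); [right|left].
  exists v; apply/seteqP; split => w /=; last by move=> ->.
  by rewrite -ev => /e_inj.
by apply/seteqP; split => // w /= ew; apply: H; exists w.
Qed.

(** Every fibre of the injection [e] is empty or a single point, so a sum over [D] becomes a series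
    over [nat], to which monotone convergence and measurability of series apply. *)
Let esum_fibers (a : D -> \bar R) : (forall v, 0 <= a v) ->
  \esum_(v in [set: D]) a v = \sum_(n <oo) \esum_(v in e @^-1` [set n]) a v.
Proof.
move=> a0; have <- : \bigcup_n (e @^-1` [set n]) = [set: D].
  by apply/seteqP; split => // v _; exists (e v).
rewrite nneseries_sum_bigcup//.
apply/trivIsetP => i j _ _ ij; apply/seteqP; split => // v /= [iv jv].
by move: ij; rewrite -iv -jv eqxx.
Qed.

Lemma ge0_integral_esum (F : D -> T -> \bar R) :
  (forall v, measurable_fun setT (F v)) -> (forall v t, 0 <= F v t) ->
  \int[mu]_t (\esum_(v in [set: D]) F v t) = \esum_(v in [set: D]) (\int[mu]_t F v t).
Proof.
move=> mF F0.
rewrite esum_fibers; last by move=> v; apply: integral_ge0.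
under eq_integral do rewrite esum_fibers//.
rewrite integral_nneseries//; last 2 first.
- move=> n; case: (fiber n) => [->|[v ->]].
    rewrite (_ : (fun t => _) = cst 0)//.
    by apply/funext => t; rewrite esum_set0.
  rewrite (_ : (fun t => _) = F v) ?setTI//.
  by apply/funext => t; rewrite esum_set1.
- by move=> n t _; apply: esum_ge0.
apply: eq_eseriesr => n _; case: (fiber n) => [->|[v ->]].
  under eq_integral do rewrite esum_set0.
  by rewrite integral0 esum_set0.
under eq_integral do rewrite esum_set1//.
by rewrite esum_set1//; exact: integral_ge0.
Qed.

Lemma ge0_measurable_esum (F : D -> T -> \bar R) :
  (forall v, measurable_fun setT (F v)) -> (forall v t, 0 <= F v t) ->
  measurable_fun setT (fun t => \esum_(v in [set: D]) F v t).
Proof.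
move=> mF F0; under eq_fun do rewrite esum_fibers//.
apply: ge0_emeasurable_sum => [n t _ _|n _]; first exact: esum_ge0.
case: (fiber n) => [->|[v ->]].
  rewrite (_ : (fun t => _) = cst 0)//.
  by apply/funext => t; rewrite esum_set0.
rewrite (_ : (fun t => _) = F v)//.
by apply/funext => t; rewrite esum_set1.
Qed.

Lemma ge0_esumZl (c : R) (a : D -> \bar R) : (0 <= c)%R -> (forall v, 0 <= a v) ->
  \esum_(v in [set: D]) (c%:E * a v) = c%:E * \esum_(v in [set: D]) a v.
Proof.
move=> c0 a0; rewrite !esum_fibers//; last by move=> v; rewrite mule_ge0// lee_fin.
rewrite -nneseriesZl; last by move=> n _; exact: esum_ge0.
apply: eq_eseriesr => n _; case: (fiber n) => [->|[v ->]].
  by rewrite !esum_set0 mule0.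
by rewrite !esum_set1// mule_ge0// lee_fin.
Qed.

End countable_sum.

Section cond_mixture.
Context (R : realType) d d1 d2 d3 (T : measurableType d) (A : measurableType d1)
  (D : measurableType d2) (B : measurableType d3).
Variables (P : probability T R) (X : T -> A) (V : T -> D) (W : T -> B).
Variables (K1 : A -> {measure set D -> \bar R}) (K2 : D -> {measure set B -> \bar R}).
Hypotheses (mX : measurable_fun setT X) (mV : measurable_fun setT V).
Hypothesis mW : measurable_fun setT W.
Hypothesis K1P : cond_distribution P X V K1.
Hypothesis K2P : cond_distribution P (fun t => (X t, V t)) W (fun xv => K2 xv.2).
Variables (e : D -> nat) (k : D -> A -> R).
Hypotheses (e_inj : injective e) (mset1 : forall v : D, measurable [set v]).
Hypothesis K1E : forall v x, K1 x [set v] = (k v x)%:E.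
Variables (phi : A -> R) (h : B -> R) (H : D -> R).
Hypotheses (mphi : measurable_fun setT phi) (phi0 : forall x, 0 <= phi x).
Hypotheses (mh : measurable_fun setT h) (h0 : forall y, 0 <= h y).
Hypothesis HE : forall v, (\int[K2 v]_y (h y)%:E = (H v)%:E)%E.

Let k0 v x : 0 <= k v x.
Proof. by rewrite -lee_fin -K1E measure_ge0. Qed.

Let H0 v : 0 <= H v.
Proof. by rewrite -lee_fin -HE integral_ge0// => y _; rewrite lee_fin. Qed.

Let mk v : measurable_fun setT (k v).
Proof.
have [/(_ [set v] (mset1 v)) + _] := K1P.
by under eq_fun do rewrite K1E; move/measurable_EFinP.
Qed.

Let mAv v : measurable (V @^-1` [set v]).
Proof. by rewrite -[X in measurable X]setTI; exact: mV. Qed.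

Let mXE E : measurable E -> measurable (X @^-1` E).
Proof. by move=> mE; rewrite -[X in measurable X]setTI; exact: mX. Qed.

Let mWC C : measurable C -> measurable (W @^-1` C).
Proof. by move=> mC; rewrite -[X in measurable X]setTI; exact: mW. Qed.

Let prob_slice v E C : measurable E -> measurable C ->
  (P (X @^-1` E `&` V @^-1` [set v] `&` W @^-1` C) =
   P (X @^-1` E `&` V @^-1` [set v]) * K2 v C)%E.
Proof.
move=> mE mC.
have [_ /(_ (E `*` [set v]) C)] := K2P.
move=> /(_ (measurableX mE (mset1 v)) mC) /=.
have -> : (fun t => (X t, V t)) @^-1` (E `*` [set v]) = X @^-1` E `&` V @^-1` [set v].
  by [].
move=> ->; rewrite (eq_integral (fun=> K2 v C)); last first.
  by move=> t; rewrite inE => -[_ /= ->].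
rewrite integral_cst; first by rewrite muleC.
apply: measurableI; [exact: mXE|exact: mAv].
Qed.

Let slice v E : measurable E ->
  (\int[P]_(t in X @^-1` E) (\1_(V @^-1` [set v]) t * h (W t))%:E =
   \int[P]_(t in X @^-1` E) (k v (X t) * H v)%:E)%E.
Proof.
move=> mE; pose G := X @^-1` E `&` V @^-1` [set v].
have mG : measurable G by apply: measurableI => //; exact: mXE.
have PG : P G \is a fin_num by exact: fin_num_measure.
have PG0 : 0 <= fine (P G) by exact: fine_ge0.
have mI : measurable_fun setT (\1_G : T -> R) by exact: measurable_indic.
have I0 t : 0 <= \1_G t :> R by rewrite indicE.
have [m mE' mint] := weighted_law P mI I0 mW.
have lhs : (\int[P]_(t in X @^-1` E) (\1_(V @^-1` [set v]) t * h (W t))%:E =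
    \int[m]_y (h y)%:E)%E.
  rewrite mint// [LHS]integral_mkcond. apply: eq_integral => t _.
  rewrite patchE /G !indicE in_setI; case: ifP => _ /=; rewrite ?mulr0//.
  by rewrite mulrC.
rewrite lhs (eq_measure_integral (mscale (NngNum PG0) (K2 v))); last first.
  move=> C mC _; transitivity ((fine (P G))%:E * K2 v C)%E; last by [].
  rewrite mE' fineK// integral_indic//; last exact: mWC.
  exact: prob_slice.
rewrite ge0_integral_mscale//=; last first.
  - by move=> y _; rewrite lee_fin.
  - exact/measurable_EFinP.
rewrite HE fineK//.
have [_ /(_ E [set v] mE (mset1 v)) ->] := K1P.
under [in RHS]eq_integral do rewrite EFinM.
rewrite ge0_integralZr//.
- by congr (_ * _)%E; apply: eq_integral => t _; rewrite K1E.
- exact: mXE.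
- by apply: measurable_funTS; apply/measurable_EFinP; exact: measurableT_comp.
- by move=> t _; rewrite lee_fin.
- by rewrite lee_fin.
Qed.

(* On [V = v] the law of [W] does not depend on [X], so that [phi (X t)] and
   [h (W t)] can be integrated one after the other. *)
Lemma cond_mixture :
  (\int[P]_t (phi (X t) * h (W t))%:E =
   \int[P]_t ((phi (X t))%:E * \esum_(v in [set: D]) (k v (X t) * H v)%:E))%E.
Proof.
have mhW : measurable_fun setT (fun t => h (W t)) by exact: measurableT_comp.
have mphiX : measurable_fun setT (fun t => phi (X t)) by exact: measurableT_comp.
have mkX v : measurable_fun setT (fun t => k v (X t)) by exact: measurableT_comp.
have m1 v : measurable_fun setT (fun t => \1_(V @^-1` [set v]) t * h (W t)).
  by apply: measurable_funM => //; exact: measurable_indic.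
have m2 v : measurable_fun setT (fun t => k v (X t) * H v) by exact: measurable_funM.
have p1 v t : 0 <= \1_(V @^-1` [set v]) t * h (W t) by rewrite mulr_ge0// indicE.
have p2 v t : 0 <= k v (X t) * H v by rewrite mulr_ge0.
have -> : (\int[P]_t ((phi (X t))%:E * \esum_(v in [set: D]) (k v (X t) * H v)%:E)
    = \int[P]_t (\esum_(v in [set: D]) (phi (X t) * (k v (X t) * H v))%:E))%E.
  apply: eq_integral => t _; rewrite -(ge0_esumZl e_inj)// => v.
  by rewrite lee_fin.
(* The events [V = v] partition the space: at each [t] only the term [v = V t] survives. *)
transitivity (\int[P]_t \esum_(v in [set: D])
    (phi (X t) * (\1_(V @^-1` [set v]) t * h (W t)))%:E)%E.
  apply: eq_integral => t _.
  transitivity (\esum_(v in [set V t]) (phi (X t) * h (W t))%:E)%E.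
    by rewrite esum_set1// lee_fin mulr_ge0.
  rewrite esum_mkcond; apply: eq_esum => v _; rewrite indicE.
  case: ifPn => [/set_mem/= ->|/negP vV]; first by rewrite mem_set// mul1r.
  rewrite memNset ?mul0r ?mulr0// => /= Vt; apply: vV.
  by rewrite -Vt; apply/mem_set.
rewrite (ge0_integral_esum _ e_inj); last 2 first.
- by move=> v; apply/measurable_EFinP; apply: measurable_funM.
- by move=> v t; rewrite lee_fin mulr_ge0.
rewrite (ge0_integral_esum _ e_inj); last 2 first.
- by move=> v; apply/measurable_EFinP; apply: measurable_funM.
- by move=> v t; rewrite lee_fin mulr_ge0.
apply: eq_esum => v _.
by apply: (eq_weighted_law (m1 v) (p1 v) (m2 v) (p2 v) mX mphi phi0) => E; exact: slice.
Qed.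

(** In the application the closed form [L] of the sum is available where [X] is positive, which
    holds almost everywhere for a gamma variable. *)
Lemma cond_mixture_ae (L : A -> R) :
  measurable_fun setT L -> (forall x, 0 <= L x) ->
  {ae P, forall t, \esum_(v in [set: D]) (k v (X t) * H v)%:E = (L (X t))%:E} ->
  (\int[P]_t (phi (X t) * h (W t))%:E = \int[P]_t (phi (X t) * L (X t))%:E)%E.
Proof.
move=> mL L0 LE; rewrite cond_mixture; apply: ge0_ae_eq_integral => //.
- apply: emeasurable_funM; first by apply/measurable_EFinP; exact: measurableT_comp.
  apply: (ge0_measurable_esum e_inj) => [v|v t].
    by apply/measurable_EFinP; apply: measurable_funM => //; exact: measurableT_comp.
  by rewrite lee_fin mulr_ge0.
- by apply/measurable_EFinP; apply: measurable_funM; exact: measurableT_comp.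
- by move=> t _; rewrite mule_ge0 ?lee_fin// esum_ge0// => v _; rewrite lee_fin mulr_ge0.
- by move=> t _; rewrite lee_fin mulr_ge0.
- by apply: filterS LE => t E _; rewrite E EFinM.
Qed.

End cond_mixture.

(** * One, two and three variables *)

(** The margin [ep] is needed because the shrunken boxes near 0 may contain points with slightly
    negative coordinates. In the variables [t + ep] all coefficients remain nonnegative and the
    constant term positive; the top coefficient [p123] is unchanged by the shift and so does not
    enter the minimum [m]. *)
Lemma multiaffine3_gt0 (R : realType) (p1 p2 p3 p12 p13 p23 p123 : R) :
  0 < p1 -> 0 < p2 -> 0 < p3 -> 0 < p12 -> 0 < p13 -> 0 < p23 -> 0 < p123 ->
  exists2 ep : R, 0 < ep & forall t1 t2 t3, - ep <= t1 -> - ep <= t2 -> - ep <= t3 ->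
    0 < 1 + p1 * t1 + p2 * t2 + p3 * t3 + p12 * t1 * t2 + p13 * t1 * t3
      + p23 * t2 * t3 + p123 * t1 * t2 * t3.
Proof.
move=> p10 p20 p30 p120 p130 p230 p1230.
pose m := Num.min 1 (Num.min p1 (Num.min p2 (Num.min p3
  (Num.min p12 (Num.min p13 p23))))).
have m0 : 0 < m by rewrite !lt_min ltr01 p10 p20 p30 p120 p130 p230.
have : m <= m by []; rewrite {2}/m !le_min.
move=> /andP[m1 /andP[mp1 /andP[mp2 /andP[mp3 /andP[mp12 /andP[mp13 mp23]]]]]].
pose s := p1 + p2 + p3 + p12 + p13 + p23 + p123.
have s0 : 0 < s by rewrite !addr_gt0.
pose ep := m / (s + 1).
have s1 : 0 < s + 1 by rewrite addr_gt0.
have ep0 : 0 < ep by rewrite divr_gt0.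
have eps : ep * (s + 1) = m by rewrite /ep divfK ?gt_eqF.
have ep1 : ep <= 1 by rewrite /ep ler_pdivrMr//; lra.
clearbody ep.
have eE : ep * p1 + ep * p2 + ep * p3 + ep * p12 + ep * p13 + ep * p23 + ep * p123
    + ep = m by rewrite -eps /s; ring.
have [q1 q2 q3] : [/\ 0 < ep * p1, 0 < ep * p2 & 0 < ep * p3] by split; rewrite mulr_gt0.
have [q12 q13 q23] : [/\ 0 < ep * p12, 0 < ep * p13 & 0 < ep * p23] by split; rewrite mulr_gt0.
have q123 : 0 < ep * p123 by rewrite mulr_gt0.
have e2 p : 0 < p -> 0 < ep * ep * p by move=> p0; apply: mulr_gt0 => //; exact: mulr_gt0.
have e3 : ep * ep * ep * p123 <= ep * p123.
  have h : ep * ep <= 1 by rewrite mulr_ile1 ?(ltW ep0).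
  by rewrite ler_pM2r// ger_pMl.
exists ep => // t1 t2 t3 h1 h2 h3.
pose y1 := t1 + ep; pose y2 := t2 + ep; pose y3 := t3 + ep.
have [y10 y20 y30] : [/\ 0 <= y1, 0 <= y2 & 0 <= y3] by split; rewrite /y1 /y2 /y3; lra.
pose c0 := 1 - (ep * p1 + ep * p2 + ep * p3)
  + (ep * ep * p12 + ep * ep * p13 + ep * ep * p23) - ep * ep * ep * p123.
pose c1 := p1 - (ep * p12 + ep * p13) + ep * ep * p123.
pose c2 := p2 - (ep * p12 + ep * p23) + ep * ep * p123.
pose c3 := p3 - (ep * p13 + ep * p23) + ep * ep * p123.
have -> : 1 + p1 * t1 + p2 * t2 + p3 * t3 + p12 * t1 * t2 + p13 * t1 * t3
    + p23 * t2 * t3 + p123 * t1 * t2 * t3 =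
  c0 + c1 * y1 + c2 * y2 + c3 * y3 + (p12 - ep * p123) * (y1 * y2)
  + (p13 - ep * p123) * (y1 * y3) + (p23 - ep * p123) * (y2 * y3)
  + p123 * (y1 * y2 * y3).
  by rewrite /c0 /c1 /c2 /c3 /y1 /y2 /y3; ring.
have c00 : 0 < c0.
  have := e2 _ p120; have := e2 _ p130; have := e2 _ p230; rewrite /c0; lra.
have E := e2 _ p1230.
have c10 : 0 <= c1 by rewrite /c1; lra.
have c20 : 0 <= c2 by rewrite /c2; lra.
have c30 : 0 <= c3 by rewrite /c3; lra.
have c120 : 0 <= p12 - ep * p123 by lra.
have c130 : 0 <= p13 - ep * p123 by lra.
have c230 : 0 <= p23 - ep * p123 by lra.
clearbody c0 c1 c2 c3 y1 y2 y3.
apply: ltr_wpDr; first by rewrite mulr_ge0 ?(ltW p1230)// mulr_ge0// mulr_ge0.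
by do 6 (apply: ltr_wpDr; first by do ?apply: mulr_ge0).
Qed.

Section laplace_corollaries.
Context (R : realType) d (T : measurableType d) (mu : probability T R).

Lemma multigamma3_laplace (lam p1 p2 p3 p12 p13 p23 p123 : R) (X1 X2 X3 : T -> R) :
  0 < lam ->
  0 < p1 -> 0 < p2 -> 0 < p3 -> 0 < p12 -> 0 < p13 -> 0 < p23 -> 0 < p123 ->
  measurable_fun setT X1 -> measurable_fun setT X2 -> measurable_fun setT X3 ->
  let P3 t1 t2 t3 := 1 + p1 * t1 + p2 * t2 + p3 * t3 + p12 * t1 * t2
    + p13 * t1 * t3 + p23 * t2 * t3 + p123 * t1 * t2 * t3 in
  multigamma (fun t : 'rV[R]_3 => P3 (t 0 0) (t 0 1) (t 0 2%:R)) lam mu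
    [tuple X1; X2; X3] ->
  forall t1 t2 t3, 0 <= t1 -> 0 <= t2 -> 0 <= t3 ->
  (\int[mu]_w (expR (- (t1 * X1 w + t2 * X2 w + t3 * X3 w)))%:E
   = (P3 t1 t2 t3 `^ (- lam))%:E)%E.
Proof.
move=> lam0 p10 p20 p30 p120 p130 p230 p1230 m1 m2 m3 P3 mg t1 t2 t3 h1 h2 h3.
have [ep ep0 Pep] := multiaffine3_gt0 p10 p20 p30 p120 p130 p230 p1230.
pose Q (t : 'rV[R]_3) := P3 (t 0 0) (t 0 1) (t 0 2%:R).
have mX i : measurable_fun setT (tnth [tuple X1; X2; X3] i).
  by case: i => [[|[|[|//]]] Hi].
have aQ : affine_in_each Q.
  move=> th; case=> [[|[|[|//]]] Hi].
  - exists (P3 0 (th 0 1) (th 0 2%:R)).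
    exists (p1 + p12 * th 0 1 + p13 * th 0 2%:R + p123 * th 0 1 * th 0 2%:R).
    by move=> s; rewrite /Q !mxE /= /P3; ring.
  - exists (P3 (th 0 0) 0 (th 0 2%:R)).
    exists (p2 + p12 * th 0 0 + p23 * th 0 2%:R + p123 * th 0 0 * th 0 2%:R).
    by move=> s; rewrite /Q !mxE /= /P3; ring.
  - exists (P3 (th 0 0) (th 0 1) 0).
    exists (p3 + p13 * th 0 0 + p23 * th 0 1 + p123 * th 0 0 * th 0 1).
    by move=> s; rewrite /Q !mxE /= /P3; ring.
pose th : 'rV[R]_3 := \row_(i < 3) [:: t1; t2; t3]`_i.
have Qep (t : 'rV[R]_3) : (forall i, - ep <= t 0 i) -> 0 < Q t.
  by move=> H; apply: Pep; exact: H.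
have := multigamma_laplace mX lam0 aQ ep0 Qep mg (th := th).
have -> : Q th = P3 t1 t2 t3 by rewrite /Q !mxE.
rewrite /laplace => <-.
  apply: eq_integral => w _; congr (expR (- _))%:E.
  by rewrite !big_ord_recl big_ord0 !mxE /= addr0 addrA.
by case=> [[|[|[|//]]] Hi]; rewrite mxE /=; apply: le_trans (_ : 0 <= _) => //;
  rewrite oppr_le0 ltW.
Qed.

Lemma multigamma2_laplace (lam a b c : R) (X1 X2 : T -> R) :
  0 < lam -> 0 < a -> 0 < b -> 0 < c ->
  measurable_fun setT X1 -> measurable_fun setT X2 ->
  let S t1 t2 := 1 + a * t1 + b * t2 + c * t1 * t2 in
  multigamma (fun t : 'rV[R]_2 => S (t 0 0) (t 0 1)) lam mu [tuple X1; X2] ->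
  forall t1 t2, 0 <= t1 -> 0 <= t2 ->
  (\int[mu]_w (expR (- (t1 * X1 w + t2 * X2 w)))%:E
   = (S t1 t2 `^ (- lam))%:E)%E.
Proof.
move=> lam0 a0 b0 c0 m1 m2 S mg t1 t2 h1 h2.
(* The bound is used at [t3 = 0], so the coefficients of the monomials containing [t3] are filled
   with 1. *)
have [ep ep0 Pep] := multiaffine3_gt0 a0 b0 ltr01 c0 ltr01 ltr01 ltr01.
pose Q (t : 'rV[R]_2) := S (t 0 0) (t 0 1).
have mX i : measurable_fun setT (tnth [tuple X1; X2] i).
  by case: i => [[|[|//]] Hi].
have aQ : affine_in_each Q.
  move=> th; case=> [[|[|//]] Hi].
  - exists (S 0 (th 0 1)); exists (a + c * th 0 1).
    by move=> s; rewrite /Q !mxE /= /S; ring.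
  - exists (S (th 0 0) 0); exists (b + c * th 0 0).
    by move=> s; rewrite /Q !mxE /= /S; ring.
pose th : 'rV[R]_2 := \row_(i < 2) [:: t1; t2]`_i.
have Qep (t : 'rV[R]_2) : (forall i, - ep <= t 0 i) -> 0 < Q t.
  move=> H; have := Pep (t 0 0) (t 0 1) 0 (H _) (H _).
  by rewrite oppr_le0 (ltW ep0) !mulr0 !addr0; apply.
have := multigamma_laplace mX lam0 aQ ep0 Qep mg (th := th).
have -> : Q th = S t1 t2 by rewrite /Q !mxE.
rewrite /laplace => <-.
  apply: eq_integral => w _; congr (expR (- _))%:E.
  by rewrite !big_ord_recl big_ord0 !mxE /= addr0.
by case=> [[|[|//]] Hi]; rewrite mxE /=; apply: le_trans (_ : 0 <= _) => //;
  rewrite oppr_le0 ltW.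
Qed.

(** Shape 0 is allowed since [V1 + V4] and [V2 + V5] can vanish; both sides are then 1. *)
Lemma multigamma1_laplace (lam a : R) (X : T -> R) :
  0 <= lam -> 0 < a -> measurable_fun setT X ->
  multigamma (fun t : 'rV[R]_1 => 1 + a * t 0 0) lam mu [tuple X] ->
  forall t, 0 <= t ->
  (\int[mu]_w (expR (- (t * X w)))%:E = ((1 + a * t) `^ (- lam))%:E)%E.
Proof.
rewrite le_eqVlt => /predU1P[<-|lam0] a0 mX mg t t0.
  move: mg; rewrite /multigamma eqxx oppr0 powRr0 => X0.
  rewrite (ae_eq_integral (fun=> 1%:E))//=.
  - by rewrite integral_cst// mul1e; exact: probability_setT.
  - by apply/measurable_EFinP; apply: measurableT_comp => //;
      apply: measurable_funN; exact: measurable_funM.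
  - apply: filterS X0 => w /(_ 0) /= Xw _.
    by rewrite (_ : X w = 0)// mulr0 oppr0 expR0.
have [ep ep0 Pep] := multiaffine3_gt0 a0 ltr01 ltr01 ltr01 ltr01 ltr01 ltr01.
pose Q (t : 'rV[R]_1) := 1 + a * t 0 0.
have mX' i : measurable_fun setT (tnth [tuple X] i) by case: i => [[|//] Hi].
have aQ : affine_in_each Q.
  move=> th; case=> [[|//] Hi]; exists 1; exists a.
  by move=> s; rewrite /Q !mxE.
have Qep (th : 'rV[R]_1) : (forall i, - ep <= th 0 i) -> 0 < Q th.
  move=> H; have := Pep (th 0 0) 0 0 (H _).
  by rewrite oppr_le0 (ltW ep0) !mulr0 !addr0; apply.
have := multigamma_laplace mX' lam0 aQ ep0 Qep mg (th := const_mx t).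
rewrite /Q mxE /laplace => <-.
  apply: eq_integral => w _; congr (expR (- _))%:E.
  by rewrite big_ord1 mxE.
by move=> i; rewrite mxE; apply: le_trans t0; rewrite oppr_le0 ltW.
Qed.

Lemma gamma_gt0_ae (lam a : R) (X : T -> R) :
  0 < lam -> 0 < a -> measurable_fun setT X ->
  (forall t, (0 <= t)%R ->
    \int[mu]_w (expR (- (t * X w)))%:E = ((1 + a * t) `^ (- lam))%:E)%E ->
  {ae mu, forall w, 0 < X w}.
Proof.
move=> lam0 a0 mX XE; pose N := X @^-1` `]-oo, 0].
have mN : measurable N by rewrite -[X in measurable X]setTI; exact: mX.
suff N0 : mu N = 0%E.
  exists N; split => // w /= /negP; rewrite -leNgt => Xw.
  by rewrite /N/= in_itv.
have Nle (n : nat) : (mu N <= ((1 + a * n%:R) `^ (- lam))%:E)%E.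
  rewrite -XE// -[leLHS](_ : \int[mu]_w (\1_N w)%:E = _)%E; last by rewrite integral_indic// setIT.
  apply: le_integral_EFin => //.
  - apply: measurableT_comp => //; apply: measurable_funN; exact: measurable_funM.
  - move=> w; rewrite indicE; case: (boolP (w \in N)) => [|_]; last exact: expR_ge0.
    rewrite inE /N/= in_itv/= => Xw.
    by rewrite -expR0 ler_expR oppr_ge0 mulr_ge0_le0.
have fN : mu N \is a fin_num by exact: fin_num_measure.
apply/eqP; rewrite eq_le measure_ge0 andbT; apply: contraT; rewrite -ltNge => N0.
pose r := fine (mu N).
have r0 : 0 < r by rewrite -lte_fin fineK.
pose n := (Num.truncn ((r^-1 `^ lam^-1) / a)).+1.
have := Nle n; rewrite -(fineK fN) -/r lee_fin leNgt => /negP[].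
have nE : r^-1 `^ lam^-1 < 1 + a * n%:R.
  have : (r^-1 `^ lam^-1) / a < n%:R by exact: truncnS_gt.
  by rewrite ltr_pdivrMr// mulrC => H; apply: lt_le_trans H _; rewrite lerDr.
rewrite powRN invf_plt ?posrE ?powR_gt0//; last by rewrite ltr_wpDr// mulr_ge0// ltW.
have rE : r^-1 = (r^-1 `^ lam^-1) `^ lam.
  by rewrite -powRrM mulVf ?gt_eqF// powRr1// invr_ge0 ltW.
rewrite [ltLHS]rE.
apply: gt0_ltr_powR => //; rewrite ?nnegrE ?powR_ge0//.
by rewrite addr_ge0// mulr_ge0// ltW.
Qed.

End laplace_corollaries.

(** * Product measures and tilted gamma laws *)

Lemma integral_product_mul (R : realType) d1 d2 (T1 : measurableType d1)
    (T2 : measurableType d2) (m1 : {sigma_finite_measure set T1 -> \bar R})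
    (m2 : {sigma_finite_measure set T2 -> \bar R}) (f : T1 -> R) (g : T2 -> R)
    (a b : R) :
  measurable_fun setT f -> (forall x, 0 <= f x) ->
  measurable_fun setT g -> (forall x, 0 <= g x) ->
  (\int[m1]_x (f x)%:E = a%:E)%E -> (\int[m2]_x (g x)%:E = b%:E)%E ->
  (\int[m1 \x m2]_z (f z.1 * g z.2)%:E = (a * b)%:E)%E.
Proof.
move=> mf f0 mg g0 fa gb.
rewrite fubini_tonelli1/=; last 2 first.
- apply/measurable_EFinP; apply: measurable_funM; exact: measurableT_comp.
- by move=> z; rewrite lee_fin mulr_ge0.
under eq_integral => x _.
  rewrite /fubini_F/=; under eq_integral do rewrite EFinM.
  rewrite ge0_integralZl_EFin// ?gb; last 2 first.
    by move=> y _; rewrite lee_fin.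
    exact/measurable_EFinP.
  over.
rewrite ge0_integralZr//= ?fa ?EFinM//.
- exact/measurable_EFinP.
- by move=> x _; rewrite lee_fin.
- by rewrite -gb integral_ge0// => y _; rewrite lee_fin.
Qed.

Lemma set1_pair (T1 T2 : Type) (x : T1) (y : T2) :
  [set (x, y)] = [set x] `*` [set y].
Proof.
by apply/seteqP; split => [[a b] [-> ->]|[a b] /= [-> ->]].
Qed.

Section gamma_exponential_tilt.
Context (R : realType) d (T : measurableType d) (P : probability T R).
Variables (lam a s c : R) (X : T -> R).
Hypotheses (lam0 : 0 < lam) (a0 : 0 < a) (s0 : 0 < s) (c0 : c <= 0).
Hypothesis mX : measurable_fun setT X.
Hypothesis XE : forall t, 0 <= t ->
  (\int[P]_w (expR (- (t * X w)))%:E = ((1 + a * t) `^ (- lam))%:E)%E.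

Lemma gamma_exponential_tilt t : 0 <= t ->
  (\int[P]_w (expR (- (t * X w)) * (s `^ (- lam) * expR (X w * c)))%:E
   = ((s * (1 + a * (t - c))) `^ (- lam))%:E)%E.
Proof.
move=> t0; have tc0 : 0 <= t - c by rewrite subr_ge0 (le_trans c0).
rewrite powRM ?(ltW s0)//; last by rewrite addr_ge0// mulr_ge0// ltW.
rewrite EFinM -XE// -ge0_integralZl_EFin ?powR_ge0//; last first.
- apply/measurable_EFinP; apply: measurableT_comp => //.
  by apply: measurable_funN; exact: measurable_funM.
apply: eq_integral => w _; rewrite -EFinM mulrCA; congr (_ * _)%:E.
by rewrite -expRD; congr expR; ring.
Qed.

Lemma gamma_cond_expectation (Y : T -> R) :
  measurable_fun setT Y -> (forall w, 0 <= Y w) ->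
  (forall t, (0 <= t)%R -> \int[P]_w (expR (- (t * X w)) * Y w)%:E
    = ((s * (1 + a * (t - c))) `^ (- lam))%:E)%E ->
  cond_expectation P X Y (fun x => s `^ (- lam) * expR (x * c)).
Proof.
move=> mY Y0 YE.
have X0 := gamma_gt0_ae lam0 a0 mX XE.
have mL : measurable_fun setT (fun x : R => s `^ (- lam) * expR (x * c)).
  by apply: measurable_funM => //; apply: measurableT_comp => //; exact: measurable_funM.
have mLX : measurable_fun setT (fun w => s `^ (- lam) * expR (X w * c)).
  exact: (measurableT_comp mL mX).
have L0 x : 0 <= s `^ (- lam) * expR (x * c) by rewrite mulr_ge0 ?powR_ge0 ?expR_ge0.
have E0 w : expR (- (0 * X w)) = 1 by rewrite mul0r oppr0 expR0.
split => //.
- apply: integrable_ge0 => //.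
  rewrite (eq_integral (fun w => (expR (- (0 * X w)) * Y w)%:E)).
    by rewrite YE// ltry.
  by move=> w _; rewrite E0 mul1r.
- apply: integrable_ge0 => //.
  rewrite (eq_integral (fun w =>
      (expR (- (0 * X w)) * (s `^ (- lam) * expR (X w * c)))%:E)).
    by rewrite gamma_exponential_tilt// ltry.
  by move=> w _; rewrite E0 mul1r.
- move=> B mB; apply/esym; apply: (laplace_unique mX X0) => //.
  + move=> t t0; under eq_integral do rewrite mulNr.
    by rewrite YE// ltry.
  + move=> t t0; under eq_integral do rewrite mulNr.
    rewrite YE// -gamma_exponential_tilt//.
    by apply: eq_integral => w _; rewrite mulNr.
Qed.

End gamma_exponential_tilt.

Lemma integral_product3_mul (R : realType) d1 d2 d3 (T1 : measurableType d1)
    (T2 : measurableType d2) (T3 : measurableType d3)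
    (m1 : probability T1 R) (m2 : probability T2 R) (m3 : probability T3 R)
    (f : T1 -> R) (g : T2 -> R) (h : T3 -> R) (a b c : R) :
  measurable_fun setT f -> (forall x, 0 <= f x) ->
  measurable_fun setT g -> (forall x, 0 <= g x) ->
  measurable_fun setT h -> (forall x, 0 <= h x) ->
  (\int[m1]_x (f x)%:E = a%:E)%E -> (\int[m2]_x (g x)%:E = b%:E)%E ->
  (\int[m3]_x (h x)%:E = c%:E)%E ->
  (\int[m1 \x m2 \x m3]_z (f z.1.1 * g z.1.2 * h z.2)%:E = (a * b * c)%:E)%E.
Proof.
move=> mf f0 mg g0 mh h0 fa gb hc.
have mfg : measurable_fun setT (fun z : T1 * T2 => f z.1 * g z.2).
  by apply: measurable_funM; exact: measurableT_comp.
have fg0 (z : T1 * T2) : 0 <= f z.1 * g z.2 by rewrite mulr_ge0.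
(* This packaging equips [m1 \x m2] with the structure that the second product requires. *)
pose m12 := product_subprobability (m1 : subprobability _ _, m2 : subprobability _ _).
have E : (\int[m12]_z (f z.1 * g z.2)%:E = (a * b)%:E)%E.
  exact: integral_product_mul mf f0 mg g0 fa gb.
exact: (integral_product_mul (m1 := m12) mfg fg0 mh h0 E hc).
Qed.

Lemma product_measure5_set1 (R : realType) (m1 m2 m3 m4 m5 : probability nat R)
    (v1 v2 v3 v4 v5 : nat) :
  (m1 \x m2 \x m3 \x m4 \x m5)%E [set (v1, v2, v3, v4, v5)] =
  (fine (m1 [set v1]) * fine (m2 [set v2]) * fine (m3 [set v3])
   * fine (m4 [set v4]) * fine (m5 [set v5]))%:E.
Proof.
rewrite !EFinM !fineK ?fin_num_measure//.
rewrite 4!set1_pair.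
have E2 := @product_measure1E _ _ _ _ R m1 m2 [set v1] [set v2].
have E3 := @product_measure1E _ _ _ _ R (m1 \x m2)%E m3 ([set v1] `*` [set v2]) [set v3].
have E4 := @product_measure1E _ _ _ _ R (m1 \x m2 \x m3)%E m4
  ([set v1] `*` [set v2] `*` [set v3]) [set v4].
have E5 := @product_measure1E _ _ _ _ R (m1 \x m2 \x m3 \x m4)%E m5
  ([set v1] `*` [set v2] `*` [set v3] `*` [set v4]) [set v5].
have M2 : measurable ([set v1] `*` [set v2]) by exact: measurableX.
have M3 : measurable ([set v1] `*` [set v2] `*` [set v3]) by exact: measurableX.
have M4 : measurable ([set v1] `*` [set v2] `*` [set v3] `*` [set v4]) by exact: measurableX.
apply: (etrans (E5 M4 _)) => //; congr (_ * _)%E.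
apply: (etrans (E4 M3 _)) => //; congr (_ * _)%E.
apply: (etrans (E3 M2 _)) => //; congr (_ * _)%E.
exact: E2.
Qed.

Theorem theorem34 (R : realType) (lam p1 p2 p3 p12 p13 p23 p123 : R) :
  0 < lam ->
  0 < p1 -> 0 < p2 -> 0 < p3 -> 0 < p12 -> 0 < p13 -> 0 < p23 -> 0 < p123 ->
  let P3 (t1 t2 t3 : R) :=
    1 + p1 * t1 + p2 * t2 + p3 * t3 + p12 * t1 * t2 + p13 * t1 * t3
      + p23 * t2 * t3 + p123 * t1 * t2 * t3 in
  let b12 := p13 * p23 / p123 ^+ 2 - p3 / p123 in
  let b13 := p12 * p23 / p123 ^+ 2 - p2 / p123 in
  let b23 := p13 * p12 / p123 ^+ 2 - p1 / p123 in
  let b123 := - (1 / p123) + p23 * p1 / p123 ^+ 2 + p13 * p2 / p123 ^+ 2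
    + p12 * p3 / p123 ^+ 2 - 2 * p23 * p13 * p12 / p123 ^+ 3 in
  0 < b12 -> 0 < b13 -> 0 < b23 -> 0 < b123 ->
  let q2 := - (p13 / p123) in
  let q3 := - (p12 / p123) in
  let q23 := - (p1 / p123) in
  let S23 (t2 t3 : R) :=
    1 + p12 / p1 * t2 + p13 / p1 * t3 + p123 / p1 * t2 * t3 in
  let S2 (t2 : R) := 1 + (- q2)^-1 * t2 in
  let S3 (t3 : R) := 1 + (- q3)^-1 * t3 in
  let a1 := b12 / (- q2) in
  let a2 := b13 / (- q3) in
  let a3 := b123 / (- q23) in
  let a4 := b12 * b23 / ((- q2) * (- q23)) in
  let a5 := b13 * b23 / ((- q3) * (- q23)) in
  let P3v (t : 'rV[R]_3) := P3 (t 0 0) (t 0 1) (t 0 2%:R) in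
  let S23v (t : 'rV[R]_2) := S23 (t 0 0) (t 0 1) in
  let S2v (t : 'rV[R]_1) := S2 (t 0 0) in
  let S3v (t : 'rV[R]_1) := S3 (t 0 0) in
  (* (a) *)
  (forall (d : measure_display) (T : measurableType d) (P : probability T R)
     (X1 X2 X3 : {RV P >-> R}),
     multigamma P3v lam P [tuple X1 : T -> R; X2 : T -> R; X3 : T -> R] ->
     exists L : R -> R -> R -> R,
       forall t2 t3 : R, 0 <= t2 -> 0 <= t3 ->
         cond_expectation P X1 (fun w => expR (- t2 * X2 w - t3 * X3 w))
           (fun x1 => L x1 t2 t3) /\
         forall x1 : R, 0 < x1 ->
           ((L x1 t2 t3)%:E =
            \esum_(v in [set: nat * nat * nat * nat * nat])
              let '(v1, v2, v3, v4, v5) := v in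
              poisson (a1 * x1) [set v1] * poisson (a2 * x1) [set v2]
              * poisson (a3 * x1) [set v3] * poisson (a4 * x1) [set v4]
              * poisson (a5 * x1) [set v5]
              * (S2 t2 ^- (v1 + v4) * S3 t3 ^- (v2 + v5)
                 * S23 t2 t3 `^ (- (lam + (v3 + v4 + v5)%:R)))%:E)%E) /\
  (* (b) *)
  (forall (d : measure_display) (T : measurableType d) (P : probability T R)
     (X1 Y2 Y3 Z2 Z3 : {RV P >-> R}) (V1 V2 V3 V4 V5 : {RV P >-> nat})
     (G2 G3 : nat -> probability R R)
     (G23 : nat -> probability (R * R)%type R),
     multigamma (fun t : 'rV[R]_1 => 1 + p1 * t 0 0) lam P
       [tuple X1 : T -> R] ->
     cond_distribution P X1 (fun w => (V1 w, V2 w, V3 w, V4 w, V5 w))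
       (fun x1 => poisson (a1 * x1) \x poisson (a2 * x1) \x poisson (a3 * x1)
                    \x poisson (a4 * x1) \x poisson (a5 * x1))%E ->
     (forall k : nat, multigamma S2v k%:R (G2 k) [tuple (@idfun R)]) ->
     (forall k : nat, multigamma S3v k%:R (G3 k) [tuple (@idfun R)]) ->
     (forall k : nat,
        multigamma S23v (lam + k%:R) (G23 k) [tuple (@fst R R); (@snd R R)]) ->
     cond_distribution P (fun w => (X1 w, (V1 w, V2 w, V3 w, V4 w, V5 w)))
       (fun w => (Y2 w, Y3 w, (Z2 w, Z3 w)))
       (fun xv => let '(_, (v1, v2, v3, v4, v5)) := xv in
                  G2 (v1 + v4)%N \x G3 (v2 + v5)%N \x G23 (v3 + v4 + v5)%N)%E ->
     multigamma P3v lam P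
       [tuple X1 : T -> R; (fun w => Y2 w + Z2 w); (fun w => Y3 w + Z3 w)]).
Proof.
move=> lam0 p10 p20 p30 p120 p130 p230 p1230 P3 b12 b13 b23 b123.
move=> b120 b130 b230 b1230 q2 q3 q23 S23 S2 S3 a1 a2 a3 a4 a5 P3v S23v S2v S3v.
have q20 : 0 < - q2 by rewrite /q2 opprK divr_gt0.
have q30 : 0 < - q3 by rewrite /q3 opprK divr_gt0.
have q230 : 0 < - q23 by rewrite /q23 opprK divr_gt0.
have a10 : 0 < a1 by rewrite divr_gt0.
have a20 : 0 < a2 by rewrite divr_gt0.
have a30 : 0 < a3 by rewrite divr_gt0.
have a40 : 0 < a4 by rewrite divr_gt0 ?mulr_gt0.
have a50 : 0 < a5 by rewrite divr_gt0 ?mulr_gt0.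
have S2_ge1 t2 : 0 <= t2 -> 1 <= S2 t2.
  by move=> h; rewrite /S2 lerDl mulr_ge0// invr_ge0 ltW.
have S3_ge1 t3 : 0 <= t3 -> 1 <= S3 t3.
  by move=> h; rewrite /S3 lerDl mulr_ge0// invr_ge0 ltW.
have S23_ge1 t2 t3 : 0 <= t2 -> 0 <= t3 -> 1 <= S23 t2 t3.
  move=> h2 h3; rewrite /S23 -!addrA lerDl.
  have [r1 r2 r3] : [/\ 0 <= p12 / p1, 0 <= p13 / p1 & 0 <= p123 / p1].
    by split; rewrite divr_ge0 ?ltW.
  apply: addr_ge0; first exact: mulr_ge0.
  by apply: addr_ge0; [exact: mulr_ge0|exact: mulr_ge0 (mulr_ge0 r3 h2) h3].
pose c (x2 x3 : R) : R := a1 * ((S2 x2)^-1 - 1) + a2 * ((S3 x3)^-1 - 1)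
  + a3 * ((S23 x2 x3)^-1 - 1) + a4 * ((S2 x2)^-1 * (S23 x2 x3)^-1 - 1)
  + a5 * ((S3 x3)^-1 * (S23 x2 x3)^-1 - 1).
(* All generating functions are evaluated at arguments in [0, 1], where each exponent is
   nonpositive. *)
have c_le0 u2 u3 : 0 <= u2 -> 0 <= u3 -> c u2 u3 <= 0.
  move=> h2 h3; have i2 := invf_le1 (lt_le_trans ltr01 (S2_ge1 _ h2)).
  have i3 := invf_le1 (lt_le_trans ltr01 (S3_ge1 _ h3)).
  have i23 := invf_le1 (lt_le_trans ltr01 (S23_ge1 _ _ h2 h3)).
  have z2 : 0 <= (S2 u2)^-1 by rewrite invr_ge0 (le_trans ler01) ?S2_ge1.
  have z3 : 0 <= (S3 u3)^-1 by rewrite invr_ge0 (le_trans ler01) ?S3_ge1.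
  have z23 : 0 <= (S23 u2 u3)^-1 by rewrite invr_ge0 (le_trans ler01) ?S23_ge1.
  have np (x y : R) : 0 < x -> y <= 1 -> x * (y - 1) <= 0.
    by move=> x0 y1; rewrite pmulr_rle0// subr_le0.
  have l2 : (S2 u2)^-1 <= 1 by rewrite i2 S2_ge1.
  have l3 : (S3 u3)^-1 <= 1 by rewrite i3 S3_ge1.
  have l23 : (S23 u2 u3)^-1 <= 1 by rewrite i23 S23_ge1.
  rewrite /c -oppr_ge0 !opprD !addr_ge0// oppr_ge0 np//; exact: mulr_ile1.
have S23_gt0 t2 t3 : 0 <= t2 -> 0 <= t3 -> 0 < S23 t2 t3.
  by move=> h2 h3; rewrite (lt_le_trans ltr01)// S23_ge1.
have factor t1 t2 t3 : 0 <= t2 -> 0 <= t3 ->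
    S23 t2 t3 * (1 + p1 * (t1 - c t2 t3)) = P3 t1 t2 t3.
  move=> h2 h3.
  have := @mixture_factorization _ p1 p2 p3 p12 p13 p23 p123 t1 t2 t3 p10 p120 p130 p1230.
  rewrite /c /a1 /a2 /a3 /a4 /a5 /S2 /S3 /q2 /q3 /q23 !opprK; apply.
  - by have := S2_ge1 _ h2; rewrite /S2 /q2 opprK => /(lt_le_trans ltr01)/lt0r_neq0.
  - by have := S3_ge1 _ h3; rewrite /S3 /q3 opprK => /(lt_le_trans ltr01)/lt0r_neq0.
  - by rewrite gt_eqF// S23_gt0.
have mix x t2 t3 : 0 < x -> 0 <= t2 -> 0 <= t3 ->
    ((S23 t2 t3 `^ (- lam) * expR (x * c t2 t3))%:E =
     \esum_(v in [set: nat * nat * nat * nat * nat])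
       let '(v1, v2, v3, v4, v5) := v in
       poisson (a1 * x) [set v1] * poisson (a2 * x) [set v2]
       * poisson (a3 * x) [set v3] * poisson (a4 * x) [set v4]
       * poisson (a5 * x) [set v5]
       * (S2 t2 ^- (v1 + v4) * S3 t3 ^- (v2 + v5)
          * S23 t2 t3 `^ (- (lam + (v3 + v4 + v5)%:R)))%:E)%E.
  move=> x0 h2 h3.
  rewrite (poisson_mixture lam (mulr_gt0 a10 x0) (mulr_gt0 a20 x0)
    (mulr_gt0 a30 x0) (mulr_gt0 a40 x0) (mulr_gt0 a50 x0)
    (lt_le_trans ltr01 (S2_ge1 _ h2)) (lt_le_trans ltr01 (S3_ge1 _ h3))
    (S23_gt0 _ _ h2 h3)).
  by congr (_ * expR _)%:E; rewrite /c; ring.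
split.
  move=> d T P X1 X2 X3 mg.
  have [m1 m2 m3] : [/\ measurable_fun setT X1, measurable_fun setT X2
    & measurable_fun setT X3] by split.
  have LT := multigamma3_laplace lam0 p10 p20 p30 p120 p130 p230 p1230 m1 m2 m3 mg.
  (* The closed form is measurable on the whole line; the Poisson series is compared with it only
     for positive [x1]. *)
  exists (fun x1 t2 t3 => S23 t2 t3 `^ (- lam) * expR (x1 * c t2 t3)).
  move=> t2 t3 h2 h3; split; last by move=> x1 x10; exact: mix.
  apply: (gamma_cond_expectation lam0 p10) => //.
  - exact: S23_gt0.
  - exact: c_le0.
  (* At [t2 = t3 = 0] the joint transform becomes that of the gamma variable [X1]. *)
  - move=> t t0; have := LT t 0 0 t0 (lexx _) (lexx _).
    rewrite !mulr0 !addr0 => <-.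
    by apply: eq_integral => w _; rewrite !mul0r !addr0.
  - apply: measurableT_comp => //; apply: measurable_funB; exact: measurable_funM.
  - move=> t t0; rewrite factor// -[RHS](LT t t2 t3)//.
    by apply: eq_integral => w _; rewrite -expRD; congr (expR _)%:E; ring.
move=> d T P X1 Y2 Y3 Z2 Z3 V1 V2 V3 V4 V5 G2 G3 G23 mgX VX mG2 mG3 mG23 YV.
have mX1 : measurable_fun setT X1 by [].
have XE := multigamma1_laplace (ltW lam0) p10 mX1 mgX.
have X10 := gamma_gt0_ae lam0 p10 mX1 XE.
rewrite /multigamma gt_eqF//.
(* The closed orthant serves as [U]; it contains the unit ball around the all-ones vector. *)
exists [set th : 'rV[R]_3 | forall i, 0 <= th 0 i].
  exists (const_mx 1); apply/nbhs_ballP; exists 1 => //= th [_ H] i.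
  have := H 0 i; rewrite /ball/= mxE ltr_norml => /andP[_].
  by rewrite ltrBlDr -ltrBlDl subrr => /ltW.
move=> th th0; pose t1 := th 0 0; pose t2 := th 0 1; pose t3 := th 0 2%:R.
have [h1 h2 h3] : [/\ 0 <= t1, 0 <= t2 & 0 <= t3] by split; exact: th0.
have P30 : 0 < P3 t1 t2 t3.
  rewrite -factor// mulr_gt0 ?S23_gt0// ltr_wpDr// mulr_ge0 ?(ltW p10)//.
  by rewrite subr_ge0 (le_trans (c_le0 _ _ h2 h3)).
split; first exact: P30.
rewrite unlock.
(* The kernel in [Y2 + Z2] and [Y3 + Z3] is split along the product [G2 \x G3 \x G23], one factor
   per measure. *)
pose h2f (y : R) := expR (- (t2 * y)); pose h3f (y : R) := expR (- (t3 * y)).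
pose h23f (z : R * R) := expR (- (t2 * z.1 + t3 * z.2)).
pose hYf (y : R * R) := h2f y.1 * h3f y.2.
pose h (y : R * R * (R * R)) := hYf y.1 * h23f y.2.
have mlin (t : R) : measurable_fun setT (fun y : R => expR (- (t * y))).
  by apply: measurableT_comp => //; apply: measurable_funN; exact: measurable_funM.
have mh23 : measurable_fun setT h23f.
  apply: measurableT_comp => //; apply: measurable_funN.
  by apply: measurable_funD; apply: measurable_funM.
have mhY : measurable_fun setT hYf.
  apply: measurable_funM; first exact: (measurableT_comp (mlin t2)).
  exact: (measurableT_comp (mlin t3)).
have mh : measurable_fun setT h.
  by apply: measurable_funM; [exact: (measurableT_comp mhY)|exact: (measurableT_comp mh23)].
have hY0 y : 0 <= hYf y by rewrite mulr_ge0 ?expR_ge0.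
have h0 y : 0 <= h y by rewrite mulr_ge0 ?expR_ge0.
pose K2 (v : nat * nat * nat * nat * nat) : {measure set (R * R * (R * R)) -> \bar R} :=
  let '(v1, v2, v3, v4, v5) := v in
  (G2 (v1 + v4)%N \x G3 (v2 + v5)%N \x G23 (v3 + v4 + v5)%N)%E.
pose H (v : nat * nat * nat * nat * nat) := let '(v1, v2, v3, v4, v5) := v in
  S2 t2 ^- (v1 + v4) * S3 t3 ^- (v2 + v5)
  * S23 t2 t3 `^ (- (lam + (v3 + v4 + v5)%:R)).
pose k (v : nat * nat * nat * nat * nat) (x : R) := let '(v1, v2, v3, v4, v5) := v in
  fine (poisson (a1 * x) [set v1]) * fine (poisson (a2 * x) [set v2])
  * fine (poisson (a3 * x) [set v3]) * fine (poisson (a4 * x) [set v4])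
  * fine (poisson (a5 * x) [set v5]).
have iq2 : 0 < (- q2)^-1 by rewrite invr_gt0.
have iq3 : 0 < (- q3)^-1 by rewrite invr_gt0.
have mid : measurable_fun setT (@idfun R) by exact: measurable_id.
have HE v : (\int[K2 v]_y (h y)%:E = (H v)%:E)%E.
  case: v => [[[[v1 v2] v3] v4] v5]; rewrite /K2 /H.
  have E2 : (\int[G2 (v1 + v4)%N]_y (h2f y)%:E = (S2 t2 ^- (v1 + v4))%:E)%E.
    rewrite (multigamma1_laplace (ler0n _ _) iq2 mid (mG2 _) h2).
    by rewrite powR_invn// (le_trans ler01) ?S2_ge1.
  have E3 : (\int[G3 (v2 + v5)%N]_y (h3f y)%:E = (S3 t3 ^- (v2 + v5))%:E)%E.
    rewrite (multigamma1_laplace (ler0n _ _) iq3 mid (mG3 _) h3).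
    by rewrite powR_invn// (le_trans ler01) ?S3_ge1.
  have E23 : (\int[G23 (v3 + v4 + v5)%N]_z (h23f z)%:E =
      (S23 t2 t3 `^ (- (lam + (v3 + v4 + v5)%:R)))%:E)%E.
    exact: (multigamma2_laplace (ltr_wpDr (ler0n _ _) lam0) (divr_gt0 p120 p10)
      (divr_gt0 p130 p10) (divr_gt0 p1230 p10) measurable_fst measurable_snd
      (mG23 _) h2 h3).
  exact: (integral_product3_mul (mlin t2) (fun y => expR_ge0 _) (mlin t3)
    (fun y => expR_ge0 _) mh23 (fun z => expR_ge0 _) E2 E3 E23).
pose K1 (x : R) : {measure set (nat * nat * nat * nat * nat) -> \bar R} :=
  (poisson (a1 * x) \x poisson (a2 * x) \x poisson (a3 * x)
    \x poisson (a4 * x) \x poisson (a5 * x))%E.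
have K1E v x : K1 x [set v] = (k v x)%:E.
  case: v => [[[[v1 v2] v3] v4] v5].
  exact: (product_measure5_set1 (poisson (a1 * x)) (poisson (a2 * x))
    (poisson (a3 * x)) (poisson (a4 * x)) (poisson (a5 * x))).
have K2P : cond_distribution P (fun w => (X1 w, (V1 w, V2 w, V3 w, V4 w, V5 w)))
    (fun w => (Y2 w, Y3 w, (Z2 w, Z3 w))) (fun xv => K2 xv.2).
  by move: YV; congr (cond_distribution _ _ _ _); apply/funext => -[x [[[[]]]]].
have mV : measurable_fun setT (fun w => (V1 w, V2 w, V3 w, V4 w, V5 w)).
  by do 4 (apply: measurable_fun_pair => //).
have mW : measurable_fun setT (fun w => (Y2 w, Y3 w, (Z2 w, Z3 w))).
  by do 2 (apply: measurable_fun_pair => //); apply: measurable_fun_pair.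
have phi0 (x : R) : 0 <= expR (- (t1 * x)) by exact: expR_ge0.
have mset1 (v : nat * nat * nat * nat * nat) : measurable [set v].
  case: v => [[[[v1 v2] v3] v4] v5]; rewrite 4!set1_pair.
  by do 4 (apply: measurableX => //).
have mL : measurable_fun setT (fun x : R => S23 t2 t3 `^ (- lam) * expR (x * c t2 t3)).
  by apply: measurable_funM => //; apply: measurableT_comp => //; exact: measurable_funM.
have L0 (x : R) : 0 <= S23 t2 t3 `^ (- lam) * expR (x * c t2 t3).
  by rewrite mulr_ge0 ?powR_ge0 ?expR_ge0.
have LE : {ae P, forall w,
    (\esum_(v in [set: nat * nat * nat * nat * nat]) (k v (X1 w) * H v)%:E
     = (S23 t2 t3 `^ (- lam) * expR (X1 w * c t2 t3))%:E)%E}.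
  apply: filterS X10 => w X1w; rewrite mix//.
  apply: eq_esum => -[[[[v1 v2] v3] v4] v5] _.
  by rewrite /k /H [LHS]EFinM !EFinM !fineK// fin_num_measure.
(* The injection of the quintuples into [nat] is [pickle]. *)
have CM := cond_mixture_ae mX1 mV mW VX K2P (pcan_inj pickleK)
  mset1 K1E (mlin t1) phi0 mh h0 HE mL L0 LE.
transitivity (\int[P]_w (expR (- (t1 * X1 w)) * h (Y2 w, Y3 w, (Z2 w, Z3 w)))%:E)%E.
  apply: eq_integral => w _; rewrite /h /hYf /h2f /h3f /h23f -!expRD.
  congr (expR _)%:E; rewrite !big_ord_recl big_ord0 /tnth /=.
  have -> : lift ord0 ord0 = 1 :> 'I_3 by exact: val_inj.
  have -> : lift ord0 (lift ord0 ord0) = 2%:R :> 'I_3 by exact: val_inj.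
  by rewrite -[th 0 ord0]/t1 -/t2 -/t3; ring.
rewrite CM (gamma_exponential_tilt p10 (S23_gt0 _ _ h2 h3) (c_le0 _ _ h2 h3) mX1 XE h1).
by rewrite factor.
Qed.
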